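(* Let $R(A,P)$ be a $K$-graded ring as defined in the context. Then the following hold. (i) The $K$-grading on $R(A,P)$ is almost free and factorial, and $R(A,P)$ has only constant invertible homogeneous elements. (ii) The variables $T_{ij}$ and $S_k$ define pairwise different, nonassociated $K$-prime generators for $R(A,P)$.
   Context: $\mathbb{K}$ is an algebraically closed field of characteristic zero. Data $A$, $P_0$. Fix integers $r,n>0$, $m\ge 0$ and a partition $n=n_\iota+\ldots+n_r$ into positive integers, starting at $\iota\in\{0,1\}$. For each $\iota\le i\le r$ fix a tuple $l_i=(l_{i1},\ldots,l_{in_i})\in\mathbb{Z}_{>0}^{n_i}$ and define the monomial $T_i^{l_i}:=T_{i1}^{l_{i1}}\cdots T_{in_i}^{l_{in_i}}$ in the polynomial ring $\mathbb{K}[T_{ij},S_k]=\mathbb{K}[T_{ij},S_k;\ \iota\le i\le r,\ 1\le j\le n_i,\ 1\le k\le m]$. Type 1: $\iota=1$. Let $A=(a_1,\ldots,a_r)$ be a list of pairwise different elements of $\mathbb{K}$. Set $I:=\{1,\ldots,r-1\}$ and $g_i:=T_i^{l_i}-T_{i+1}^{l_{i+1}}-(a_{i+1}-a_i)$ for $i\in I$. Let $P_0$ be the $r\times(n+m)$ integer matrix whose $i$-th row ($1\le i\le r$) has $l_i$ in the $n_i$ positions corresponding to $T_{i1},\ldots,T_{in_i}$ and zeros elsewhere (in particular the last $m$ columns, corresponding to $S_1,\ldots,S_m$, are zero). Type 2: $\iota=0$. Let $A=(a_0,\ldots,a_r)$ be a $2\times(r+1)$-matrix over $\mathbb{K}$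 with pairwise linearly independent columns $a_i\in\mathbb{K}^2$. Set $I:=\{0,\ldots,r-2\}$ and, for $i\in I$, let $g_i$ be the determinant of the $3\times3$ matrix with columns $(T_i^{l_i},a_i),(T_{i+1}^{l_{i+1}},a_{i+1}),(T_{i+2}^{l_{i+2}},a_{i+2})$ (first row the monomials, below it the vectors $a_i,a_{i+1},a_{i+2}$). Let $P_0$ be the $r\times(n+m)$ integer matrix whose $i$-th row ($1\le i\le r$) has $-l_0$ in the positions of $T_{01},\ldots,T_{0n_0}$, $l_i$ in the positions of $T_{i1},\ldots,T_{in_i}$, and zeros elsewhere. Construction of $R(A,P)$. Fix $1\le s\le n+m-r$, choose an integral $s\times(n+m)$ matrix $d$ and let $P$ be the $(r+s)\times(n+m)$ matrix obtained by stacking $P_0$ on top of $d$. It is required that the columns of $P$ are pairwise different primitive vectors of $\mathbb{Z}^{r+s}$ generating $\mathbb{Q}^{r+s}$ as a vector space. Let $P^*$ be the transpose of $P$, $K:=\mathbb{Z}^{n+m}/\mathrm{im}(P^* )$ and $Q\colon\mathbb{Z}^{n+m}\to K$ the projection. Set $\deg(T_{ij}):=Q(e_{ij})$, $\deg(S_k):=Q(e_k)$ with the canonical basis vectors $e_{ij},e_k$ corresponding to the variables. The $g_i$ are homogeneous, and $R(A,P):=\mathbb{K}[T_{ij},S_k]/\langle g_i;\ i\in I\rangle$ is a $K$-graded algebra. Terminology. The $K$-grading is almost free if, after removing any one of the variables $T_{ij}$, $S_k$, the degrees of the remaining variables still generate $K$ as a group. A $K$-prime is a homogeneous non-zero non-unit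 which, whenever it divides a product of homogeneous elements, divides one of the factors. The grading is factorial if there is unique factorization in the multiplicative monoid of non-zero homogeneous elements, i.e. every non-zero homogeneous non-unit is a product of $K$-primes. ''Only constant invertible homogeneous elements'' means every homogeneous unit lies in $\mathbb{K}^*$. *)

(* Defs.v *)
From HB Require Import structures.
From mathcomp Require Import all_boot all_order all_algebra.
From mathcomp Require Import boolp.
From mathcomp Require Export mpoly.

Set Implicit Arguments.
Unset Strict Implicit.
Unset Printing Implicit Defensive.

Import GRing.Theory.
Local Open Scope ring_scope.
Local Open Scope quotient_scope.

Section QuotientRing.
Variables (A : comNzRingType) (k : nat) (g : 'I_k -> A).

(* The ideal <g_i; i < k>, as a boolean predicate by classical decidability. *)
Definition gen_ideal : {pred A} :=
  fun x => `[< exists c : 'I_k -> A, x = \sum_i c i * g i >].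

Fact gen_ideal_zmod_closed : zmod_closed gen_ideal.
Proof.
split=> [|x y /asboolP[c ->] /asboolP[e ->]]; apply/asboolP.
  by exists (fun=> 0); rewrite big1 // => i _; rewrite mul0r.
exists (fun i => c i - e i); rewrite -sumrB.
by apply: eq_bigr => i _; rewrite mulrBl.
Qed.

HB.instance Definition _ :=
  GRing.isZmodClosed.Build A gen_ideal gen_ideal_zmod_closed.

Fact gen_idealM a x : x \in gen_ideal -> a * x \in gen_ideal.
Proof.
move=> /asboolP[c ->]; apply/asboolP; exists (fun i => a * c i).
by rewrite mulr_sumr; apply: eq_bigr => i _; rewrite mulrA.
Qed.

(* [{ideal_quot I}] only carries a ring structure when I is a proper ideal; here the
   ideal is arbitrary, so that the quotient is only a [comPzRingType]. *)
Definition quot_ring : Type := {ideal_quot gen_ideal}.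

HB.instance Definition _ := GRing.Zmodule.on quot_ring.
HB.instance Definition _ := EqQuotient.on quot_ring.

Definition qclass (x : A) : quot_ring := \pi_{ideal_quot gen_ideal} x.

Fact qclassP x y : reflect (qclass x = qclass y) (x - y \in gen_ideal).
Proof. by rewrite Quotient.idealrBE; apply: (iffP eqP). Qed.

Fact qclass_repr (x : quot_ring) : qclass (repr x) = x.
Proof. exact: reprK. Qed.

Fact qclassB : zmod_morphism qclass.
Proof. by move=> x y; rewrite /qclass raddfB. Qed.

HB.instance Definition _ :=
  GRing.isZmodMorphism.Build A quot_ring qclass qclassB.

Definition qone : quot_ring := qclass 1.
Definition qmul (x y : quot_ring) : quot_ring := qclass (repr x * repr y).

Fact qclass_mul x y : qmul (qclass x) (qclass y) = qclass (x * y).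
Proof.
apply/qclassP.
have Ex z : repr (qclass z) - z \in gen_ideal by apply/qclassP/qclass_repr.
set a := repr _; set b := repr _.
have -> : a * b - x * y = b * (a - x) + x * (b - y).
  by rewrite !mulrBr addrA (mulrC b x) subrK (mulrC b a).
by rewrite rpredD // gen_idealM // Ex.
Qed.

Fact qmulA : associative qmul.
Proof.
move=> x y z; rewrite -[x]qclass_repr -[y]qclass_repr -[z]qclass_repr.
by rewrite !qclass_mul mulrA.
Qed.

Fact qmulC : commutative qmul.
Proof. by move=> x y; rewrite /qmul mulrC. Qed.

Fact qmul1 : left_id qone qmul.
Proof. by move=> x; rewrite -[x]qclass_repr qclass_mul mul1r. Qed.

Fact qmulDl : left_distributive qmul +%R.
Proof.
move=> x y z; rewrite -[x]qclass_repr -[y]qclass_repr -[z]qclass_repr.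
by rewrite -raddfD !qclass_mul mulrDl raddfD.
Qed.

HB.instance Definition _ :=
  GRing.Zmodule_isComPzRing.Build quot_ring qmulA qmulC qmul1 qmulDl.

Fact qclass_monoid_morphism : monoid_morphism qclass.
Proof. by split=> // x y; rewrite -qclass_mul. Qed.

HB.instance Definition _ :=
  GRing.isMonoidMorphism.Build A quot_ring qclass qclass_monoid_morphism.

End QuotientRing.

(* A commutative ring R graded by W; [comp w] is the component of degree w. *)
Section GradedRing.
Variables (W : zmodType) (R : comPzRingType) (comp : W -> R -> Prop).

Definition homogeneous (x : R) : Prop := exists w, comp w x.

Definition is_unit (x : R) : Prop := exists y, x * y = 1.

Definition divides (x y : R) : Prop := exists z, y = x * z.

Definition associated (x y : R) : Prop := exists2 u, is_unit u & y = u * x.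

Definition graded_prime (p : R) : Prop :=
  [/\ homogeneous p, p <> 0, ~ is_unit p &
      forall x y, homogeneous x -> homogeneous y ->
        divides p (x * y) -> divides p x \/ divides p y].

(* The first clause says that the non-zero homogeneous elements do form a
   multiplicative monoid; with it, factorizations into homogeneous primes are
   automatically unique. *)
Definition factorial_grading : Prop :=
  (forall x y, homogeneous x -> homogeneous y ->
     x <> 0 -> y <> 0 -> x * y <> 0) /\
  (forall x, homogeneous x -> x <> 0 -> ~ is_unit x ->
     exists s : seq R,
       (forall p, p \in s -> graded_prime p) /\ x = \prod_(p <- s) p).

Definition almost_free (N : nat) (deg : 'I_N -> W) : Prop :=
  forall (i : 'I_N) (w : W),
    exists c : 'I_N -> int, w = \sum_(j | j != i) deg j *~ c j.

(* The x_i generate R as an algebra over the image of [const]. *)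
Definition algebra_generators (F : Type) (const : F -> R)
    (N : nat) (x : 'I_N -> R) : Prop :=
  forall S : R -> Prop,
    (forall a, S (const a)) -> (forall i, S (x i)) ->
    (forall y z, S y -> S z -> S (y + z)) ->
    (forall y z, S y -> S z -> S (y * z)) ->
    forall y, S y.

End GradedRing.

Section DegreeGroup.
Variables (M N : nat) (P : 'M[int]_(M, N)).

(* The image of the transpose P^* : Z^M -> Z^N. *)
Definition im_dual : {pred 'cV[int]_N} :=
  fun v => `[< exists u : 'cV[int]_M, v = P^T *m u >].

Fact im_dual_zmod_closed : zmod_closed im_dual.
Proof.
split=> [|x y /asboolP[u ->] /asboolP[v ->]]; apply/asboolP.
  by exists 0; rewrite mulmx0.
by exists (u - v); rewrite mulmxBr.
Qed.

HB.instance Definition _ :=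
  GRing.isZmodClosed.Build 'cV[int]_N im_dual im_dual_zmod_closed.

Definition degree_group : zmodType := {ideal_quot im_dual}.

Definition degree_proj (v : 'cV[int]_N) : degree_group :=
  \pi_{ideal_quot im_dual} v.

Definition vdeg (i : 'I_N) : degree_group := degree_proj (delta_mx i 0).

Definition primitive_vector (n : nat) (v : 'cV[int]_n) : Prop :=
  (\big[gcdn/0]_(i < n) `|v i 0%R|)%N = 1%N.

Definition admissible_matrix : Prop :=
  [/\ injective (fun j => col j P),
      forall j, primitive_vector (col j P) &
      row_full (map_mx (intr : int -> rat) P)^T].

Definition mnm_degree (u : 'X_{1..N}) : degree_group :=
  \sum_i vdeg i *+ u i.

Definition mpoly_component (F : comNzRingType) (w : degree_group)
    (p : {mpoly F[N]}) : Prop :=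
  forall u, u \in msupp p -> mnm_degree u = w.

End DegreeGroup.

(* Blocks are numbered from 0: for Type 1, whose blocks are traditionally
   numbered 1, ..., r, block i consists of the variables T_(i+1)j. *)
Inductive block_data (F : Type) (r : nat) : Type :=
  | TypeOne of 'I_r -> F
  | TypeTwo of 'M[F]_(2, r.+1).

Definition nblocks (F : Type) (r : nat) (A : block_data F r) : nat :=
  match A with TypeOne _ => r | TypeTwo _ => r.+1 end.

Definition block_data_ok (F : fieldType) (r : nat) (A : block_data F r) :=
  match A with
  | TypeOne a => injective a
  | TypeTwo a => forall i j, i != j -> free [:: col i a; col j a]
  end.

Fact consecutive_subproof (e r : nat) (i : 'I_r.-1) (v : 'I_e.+2) :
  (i + v < e + r)%N.
Proof.
case: r i => [[]//|r] i; rewrite addnS ltnS addnC /=.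
case: r i => [[]//|r] i; rewrite addnS -addSn.
by rewrite leq_add // -ltnS.
Qed.

(* The v-th of the e+2 consecutive blocks starting at block i, among e + r. *)
Definition consecutive (e r : nat) (i : 'I_r.-1) (v : 'I_e.+2) : 'I_(e + r) :=
  Ordinal (consecutive_subproof i v).

Section Blocks.
Variables (b : nat) (n_ : 'I_b -> nat) (m : nat).
Variable l : forall i, 'I_(n_ i) -> nat.

Definition nvars : nat := \sum_i n_ i + m.

(* The position of T_ij; that of S_k is [rshift _ k]. *)
Definition posT (i : 'I_b) (j : 'I_(n_ i)) : 'I_nvars :=
  lshift m (tagnat.Rank i j).

Definition block_monomial (F : nzRingType) (i : 'I_b) : {mpoly F[nvars]} :=
  \prod_(j < n_ i) 'X_(posT j) ^+ l j.

Definition block_row (i : 'I_b) : 'rV[int]_nvars :=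
  \sum_(j < n_ i) (l j)%:Z *: delta_mx 0 (posT j).

End Blocks.

Arguments nvars {b} n_ m.

Definition relations (F : comNzRingType) (r m : nat) (A : block_data F r) :
  forall (n_ : 'I_(nblocks A) -> nat) (l : forall i, 'I_(n_ i) -> nat),
    'I_r.-1 -> {mpoly F[nvars n_ m]} :=
  match A with
  | TypeOne a => fun n_ l i =>
      let blk : 'I_2 -> 'I_r := @consecutive 0 r i in
      block_monomial m l F (blk 0) - block_monomial m l F (blk 1)
      - (a (blk 1) - a (blk 0))%:MP
  | TypeTwo a => fun n_ l i =>
      let blk : 'I_3 -> 'I_r.+1 := @consecutive 1 r i in
      \det (col_mx (\row_(v < 3) block_monomial m l F (blk v))
                   (\matrix_(u < 2, v < 3) (a u (blk v))%:MP) : 'M_(1 + 2))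
  end.

Definition P0 (F : Type) (r m : nat) (A : block_data F r) :
  forall (n_ : 'I_(nblocks A) -> nat) (l : forall i, 'I_(n_ i) -> nat),
    'M[int]_(r, nvars n_ m) :=
  match A with
  | TypeOne _ => fun n_ l => \matrix_(i < r) block_row m l i
  | TypeTwo _ => fun n_ l =>
      \matrix_(i < r) (block_row m l (lift ord0 i) - block_row m l ord0)
  end.

Section RAP.
Variables (F : comNzRingType) (r m s : nat) (A : block_data F r).
Variables (n_ : 'I_(nblocks A) -> nat) (l : forall i, 'I_(n_ i) -> nat).
Variable d : 'M[int]_(s, nvars n_ m).

Definition Pmx : 'M[int]_(r + s, nvars n_ m) := col_mx (P0 m l) d.

Definition RAP : comPzRingType := quot_ring (relations m l).

Definition RAP_class (p : {mpoly F[nvars n_ m]}) : RAP :=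
  qclass (relations m l) p.

Definition RAP_const (c : F) : RAP := RAP_class c%:MP.

Definition RAP_var (i : 'I_(nvars n_ m)) : RAP := RAP_class 'X_i.

(* The grading induced on the quotient by the grading of F[T_ij, S_k]. *)
Definition RAP_component (w : degree_group Pmx) (x : RAP) : Prop :=
  exists2 p, mpoly_component w p & x = RAP_class p.

End RAP.

Arguments RAP_const {F r} m {A n_} l c.
Arguments RAP_var {F r} m {A n_} l i.
Arguments RAP_component {F r m s A n_} l d w x.

(* Main.v *)
(**
  Write K_0 for the degree group of P_0. A block polynomial T_i^l_i takes in
  R(A, P_0) the value of a linear form a_i(z) in two elements z = (z_0, z_1), so
  the K_0-homogeneous elements are the products of a constant, of variables and
  of linear forms in z not proportional to any a_i: after division by the
  largest possible monomial, a K_0-homogeneous polynomial is a binary form in z,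
  which splits since the field is algebraically closed. These factors are
  K_0-prime: each of them vanishes at a point of Spec R(A, P) at which any
  prescribed finite list of factors not associated to it does not vanish.

  The kernel of K_0 -> K is freely generated by the rows of d, because the rows
  of P are independent. Adding one row at a time, it remains to see that
  factoriality passes to a coarsening whose kernel is infinite cyclic. The
  homogeneous elements of the coarser grading behave like Laurent polynomials
  over the homogeneous elements of the finer one: Gauss' lemma (through lowest
  components) shows that primes stay prime, and a pseudo-Euclidean division
  which decreases the width shows that a primitive element is a product of
  primes.
*)

Require Import Defs.
From HB Require Import structures.
From mathcomp Require Import all_boot all_order all_algebra.
From mathcomp Require Import boolp ring.

Set Implicit Arguments.
Unset Strict Implicit.
Unset Printing Implicit Defensive.

Import Order.TTheory GRing.Theory Num.Theory.
Local Open Scope ring_scope.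

(** * Gradings and factoriality *)

(** The ring is not known beforehand to be a domain, so cancellation is available only against
    homogeneous elements, and this property has to be carried along each coarsening. An infinite
    cyclic kernel is what orders the components lying in one coarse degree: every non-zero
    homogeneous element gets a lowest and a highest component. This is why rows are added one at a
    time, and torsion in the degree group does no harm, as that group itself is never ordered. No
    unit of degree [e] need exist, so the comparison with Laurent polynomials is not literal:
    division works only up to factors homogeneous for the finer grading, and Gauss' lemma removes
    these afterwards for primitive elements. All gradings are indexed by vectors of Z^N, each with
    its own lattice of vectors of degree zero, so that no maps between quotient groups occur. Both
    types of rings are pencils of block monomials; only block 0 may be empty. *)

Section Homogeneous.
Variables (F : fieldType) (R : comPzRingType) (cst : {rmorphism F -> R}).
Variables (V : zmodType).

(** Instead of a direct sum decomposition, two consequences of taking homogeneous components are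
    recorded: a cofactor between homogeneous elements may be chosen homogeneous ([grading_div]), and
    a homogeneous zero divisor already kills a non-zero homogeneous element ([grading_full]). *)
Record grading (C : V -> R -> Prop) : Prop := Grading {
  grading0 : forall w, C w 0;
  gradingB : forall w x y, C w x -> C w y -> C w (x - y);
  gradingM : forall v w x y, C v x -> C w y -> C (v + w) (x * y);
  grading_cst : forall a, C 0 (cst a);
  grading_div : forall v w p x t, C v p -> C w x -> x = p * t ->
    exists2 t', C (w - v) t' & x = p * t';
  grading_full : forall v a t, C v a -> a * t = 0 -> t <> 0 ->
    exists t', [/\ homogeneous C t', t' <> 0 & a * t' = 0] }.

(* Here p may be 0: this case says that there are no homogeneous zero divisors. *)
Definition prime_like (C : V -> R -> Prop) (p : R) :=
  forall x y, homogeneous C x -> homogeneous C y ->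
    divides p (x * y) -> divides p x \/ divides p y.

(* Unlike in factorial_grading, homogeneous units are included: they are thereby
   constants, see homogeneous_unit_cst. *)
Definition const_factorial (C : V -> R -> Prop) : Prop :=
  (forall x y, homogeneous C x -> homogeneous C y ->
     x <> 0 -> y <> 0 -> x * y <> 0) /\
  (forall x, homogeneous C x -> x <> 0 ->
     exists c s, [/\ c != 0, forall p, p \in s -> graded_prime C p &
                     x = cst c * \prod_(p <- s) p]).

Lemma dividesMl (p x y : R) : divides p x -> divides p (x * y).
Proof. by move=> [z ->]; exists (z * y); rewrite mulrA. Qed.

Lemma dividesMr (p x y : R) : divides p y -> divides p (x * y).
Proof. by rewrite mulrC; apply: dividesMl. Qed.

Lemma dividesD (p x y : R) : divides p x -> divides p y -> divides p (x + y).
Proof. by move=> [z ->] [t ->]; exists (z + t); rewrite mulrDr. Qed.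

Lemma dividesB (p x y : R) : divides p x -> divides p y -> divides p (x - y).
Proof. by move=> [z ->] [t ->]; exists (z - t); rewrite mulrBr. Qed.

Lemma divides_trans (p q x : R) : divides p q -> divides q x -> divides p x.
Proof. by move=> dpq [t ->]; apply: dividesMl. Qed.

Lemma divides0 (x : R) : divides 0 x <-> x = 0.
Proof. by split=> [[t ->]|->]; [rewrite mul0r | exists 0; rewrite mulr0]. Qed.

Lemma divides_unit (p u : R) : divides p u -> is_unit u -> is_unit p.
Proof. by move=> [t ->] [y]; exists (t * y); rewrite mulrA. Qed.

Lemma is_unit_cst c : c != 0 -> is_unit (cst c).
Proof. by move=> c0; exists (cst c^-1); rewrite -rmorphM divff ?rmorph1. Qed.

Lemma divides_prod_mem (s : seq R) p : p \in s -> divides p (\prod_(q <- s) q).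
Proof.
move=> ps; rewrite (perm_big _ (perm_to_rem ps)) big_cons.
by eexists.
Qed.

Section OneGrading.
Variables (C : V -> R -> Prop).
Hypothesis C_grading : grading C.

Lemma gradingN w x : C w x -> C w (- x).
Proof.
by move=> Cx; rewrite -sub0r; apply: gradingB => //; apply: grading0.
Qed.

Lemma gradingD w x y : C w x -> C w y -> C w (x + y).
Proof.
by move=> Cx Cy; rewrite -[y]opprK; apply: gradingB => //; apply: gradingN.
Qed.

Lemma grading1 : C 0 1.
Proof. by rewrite -(rmorph1 cst); apply: grading_cst. Qed.

Lemma homogeneous_cst c : homogeneous C (cst c).
Proof. by exists 0; apply: grading_cst. Qed.

Lemma homogeneous1 : homogeneous C 1.
Proof. by exists 0; apply: grading1. Qed.

Lemma homogeneousM x y :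
  homogeneous C x -> homogeneous C y -> homogeneous C (x * y).
Proof. by move=> [v Cx] [w Cy]; exists (v + w); apply: gradingM. Qed.

Lemma homogeneous_div p x t : homogeneous C p -> homogeneous C x -> x = p * t ->
  exists2 t', homogeneous C t' & x = p * t'.
Proof.
move=> [v Cp] [w Cx] /(grading_div C_grading Cp Cx)[t' Ct' ->].
by exists t' => //; exists (w - v).
Qed.

Lemma homogeneous_prod (s : seq R) : (forall p, p \in s -> homogeneous C p) ->
  homogeneous C (\prod_(p <- s) p).
Proof.
elim: s => [|p s IHs] hs; rewrite ?big_nil ?big_cons.
  exact: homogeneous1.
apply: homogeneousM; first by apply: hs; rewrite mem_head.
by apply: IHs => q qs; apply: hs; rewrite inE qs orbT.
Qed.

Hypothesis C_fact : const_factorial C.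

(** The factor [t] is arbitrary: [grading_full] replaces it by a homogeneous one, to which the
    absence of homogeneous zero divisors applies. *)
Lemma homogeneous_reg a t : homogeneous C a -> a <> 0 -> a * t = 0 -> t = 0.
Proof.
move=> ha a0 at0; apply: contrapT => t0.
have [v Ca] := ha.
have [t' [ht' t'0 E]] := grading_full C_grading Ca at0 t0.
exact: (C_fact.1 a t').
Qed.

Lemma homogeneous_can a x y :
  homogeneous C a -> a <> 0 -> a * x = a * y -> x = y.
Proof.
move=> ha a0 E; apply/eqP; rewrite -subr_eq0; apply/eqP.
by apply: (homogeneous_reg ha a0); rewrite mulrBr E subrr.
Qed.

Lemma homogeneous_unit_cst x : (1 : R) <> 0 -> homogeneous C x -> is_unit x ->
  exists2 c, c != 0 & x = cst c.
Proof.
move=> nz hx ux; have x0 : x <> 0.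
  by move=> x0; case: ux => y; rewrite x0 mul0r => /esym.
have [c [[|p s] [c0 sP E]]] := C_fact.2 x hx x0.
  by exists c => //; rewrite E big_nil mulr1.
have [_ _ pU _] := sP p (mem_head p s); case: pU.
apply: divides_unit ux; rewrite E big_cons.
by apply/dividesMr/dividesMl; exists 1; rewrite mulr1.
Qed.

Lemma const_factorial_factorial : factorial_grading C.
Proof.
split=> [|x hx x0 xU]; first exact: C_fact.1.
have [c [[|p s] [c0 sP E]]] := C_fact.2 x hx x0.
  by case: xU; rewrite E big_nil mulr1; apply: is_unit_cst.
(* The constant is absorbed into the first prime, whose multiple by a non-zero constant is again
   prime. *)
exists (cst c * p :: s); split=> [q|]; last by rewrite E !big_cons mulrA.
rewrite inE => /orP[/eqP->|qs]; last by apply: sP; rewrite inE qs orbT.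
have [hp p0 pU pP] := sP p (mem_head p s).
have pcp : divides p (cst c * p) by apply: dividesMr; exists 1; rewrite mulr1.
have cpp : divides (cst c * p) p.
  by exists (cst c^-1); rewrite mulrAC -rmorphM divff // rmorph1 mul1r.
split.
- exact: homogeneousM (homogeneous_cst c) hp.
- move=> cp0; case: p0; case: cpp => t Et.
  by rewrite Et cp0 mul0r.
- by move/(divides_unit pcp).
- move=> y z hy hz /(divides_trans pcp) /(pP y z hy hz).
  by case=> d; [left|right]; apply: divides_trans d.
Qed.

End OneGrading.

(** * Coarsening along an infinite cyclic kernel *)

Section Coarsening.
Variables (C D : V -> R -> Prop) (e : V).
Hypotheses (C_grading : grading C) (D_grading : grading D).

(** An expansion into components of degrees [v], [v + e], and so on, as for a Laurent polynomial.
    Components may be 0, so [n] only bounds the width and [v] need not be a degree that occurs. *)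
Fixpoint spread (v : V) (n : nat) (x : R) : Prop :=
  if n is n'.+1 then
    exists c x', [/\ C v c, spread (v + e) n' x' & x = c + x']
  else x = 0.

Hypothesis C_in_D : forall w i x, C (w + e *~ i) x -> D w x.
Hypothesis D_spread :
  forall w x, D w x -> exists i n, spread (w + e *~ i) n x.
(** The form in which independence of the degrees [v + e *+ n] enters: the part of degree [v] of
    [c + x = p * t] is again a multiple of [p]. The case [p = 0] gives uniqueness of lowest
    components. *)
Hypothesis low_div : forall v w n c x p t,
  C v c -> spread (v + e) n x -> C w p -> c + x = p * t ->
  exists2 t', C (v - w) t' & c = p * t'.

Lemma spread0 v n : spread v n 0.
Proof.
elim: n v => //= n IHn v; exists 0, 0; split=> //; last by rewrite addr0.
exact: grading0.
Qed.

Lemma spreadB v n x y : spread v n x -> spread v n y -> spread v n (x - y).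
Proof.
elim: n v x y => [|n IHn] v x y /=; first by move=> -> ->; rewrite subr0.
move=> [c [x' [Cc Sx ->]]] [d [y' [Cd Sy ->]]].
exists (c - d), (x' - y'); split; first exact: gradingB.
  exact: IHn.
by rewrite opprD addrACA.
Qed.

Lemma spreadN v n x : spread v n x -> spread v n (- x).
Proof. by move=> Sx; rewrite -sub0r; apply: spreadB => //; apply: spread0. Qed.

Lemma spreadD v n x y : spread v n x -> spread v n y -> spread v n (x + y).
Proof.
by move=> Sx Sy; rewrite -[y]opprK; apply: spreadB => //; apply: spreadN.
Qed.

Lemma spread_leq v n n' x : (n <= n')%N -> spread v n x -> spread v n' x.
Proof.
elim: n' n v x => [[]//|n' IH] [|n] v x //=; last first.
  move=> nn' [c [x' [Cc Sx ->]]]; exists c, x'; split=> //.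
  exact: IH Sx.
by move=> _ ->; exact: (spread0 v n'.+1).
Qed.

Lemma spread_shift v q n x : spread (v + e *+ q) n x -> spread v (q + n) x.
Proof.
elim: q v => [|q IHq] v; first by rewrite addr0.
rewrite mulrS addrA => /IHq Sx; exists 0, x.
by split; rewrite ?add0r //; apply: grading0.
Qed.

Lemma spread_homM v w n a x : C w a -> spread v n x -> spread (w + v) n (a * x).
Proof.
move=> Ca; elim: n v x => [|n IHn] v x /=; first by move->; rewrite mulr0.
move=> [c [x' [Cc Sx ->]]]; exists (a * c), (a * x').
by split; [exact: gradingM | rewrite -addrA; apply: IHn | rewrite mulrDr].
Qed.

Lemma spread_hom v n x : C v x -> spread v n.+1 x.
Proof.
by move=> Cx; exists x, 0; split=> //; [apply: spread0 | rewrite addr0].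
Qed.

Lemma spreadM v w n m x y :
  spread v n x -> spread w m y -> spread (v + w) (n + m) (x * y).
Proof.
move=> + Sy; elim: n v x => [|n IHn] v x.
  by move=> /= ->; rewrite mul0r; apply: spread0.
move=> [c [x' [Cc Sx ->]]]; rewrite mulrDl; apply: spreadD.
  apply: (@spread_leq _ m); first exact: leq_addl.
  exact: spread_homM.
rewrite addSn -add1n; apply: spread_shift; rewrite mulr1n addrAC; exact: IHn.
Qed.

Lemma spread_last v n x : spread v n.+1 x ->
  exists c x', [/\ C (v + e *+ n) c, spread v n x' & x = x' + c].
Proof.
elim: n v x => [|n IHn] v x.
  by move=> [c [x' [Cc /= -> ->]]]; exists c, 0; rewrite !addr0 add0r.
move=> [c [x' [Cc /IHn[d [y [Cd Sy ->]]] ->]]].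
exists d, (c + y); split; [|by exists c, y|by rewrite addrA].
by rewrite mulrS addrA.
Qed.

Lemma low_eq0 v n c x : C v c -> spread (v + e) n x -> c + x = 0 -> c = 0.
Proof.
move=> Cc Sx cx0.
have E : c + x = 0 * 0 by rewrite mulr0.
have [t _ ->] := low_div Cc Sx (grading0 C_grading 0) E.
by rewrite mul0r.
Qed.

(** Moving [x] to the other side turns its lowest component into that of an expansion of 0, so it
    vanishes; then the next component is the lowest. *)
Lemma spread_top_eq0 v n x : spread v n x -> C (v + e *+ n) x -> x = 0.
Proof.
elim: n v x => [//|n IHn] v x [c [x' [Cc Sx E]]] Cx.
have c0 : c = 0.
  apply: (@low_eq0 v n.+1 c (x' - x)) => //; last by rewrite addrA -E subrr.
  apply: spreadB; first exact: spread_leq Sx.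
  rewrite -addn1; apply: spread_shift; apply: spread_hom.
  by rewrite -addrA -mulrS.
rewrite E c0 add0r in Cx *; apply: IHn Sx _.
by rewrite -addrA -mulrS.
Qed.

(** Comparing the two expansions shows that the components of the first below [v + e *+ q] vanish.
    The bound [n] is simply kept instead of being lowered by [q]. *)
Lemma spread_trunc v q n n' x :
  spread v n x -> spread (v + e *+ q) n' x -> spread (v + e *+ q) n x.
Proof.
elim: q v n x => [|q IHq] v n x; first by rewrite addr0.
rewrite mulrS addrA; case: n => [|n]; first by move=> /= ->.
move=> [c [x' [Cc Sx E]]] Sx'.
have c0 : c = 0.
  apply: (@low_eq0 v (n + (q + n')) c (x' - x)) => //; last first.
    by rewrite addrA -E subrr.
  apply: spreadB; first by apply: spread_leq Sx; apply: leq_addr.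
  by apply: (@spread_leq _ (q + n')); [exact: leq_addl | exact: spread_shift].
rewrite E c0 add0r in Sx' *.
by apply: (@spread_leq _ n) => //; apply: IHq.
Qed.

(** Long division from the bottom: [low_div] divides the lowest component by [p], and the result is
    subtracted from [x]. Regularity of [p] settles the end, where [p * x = 0]. *)
Lemma spread_div v w n p x : C w p -> spread v n (p * x) ->
  (forall t, p * t = 0 -> t = 0) -> spread (v - w) n x.
Proof.
move=> Cp Sx p_reg; elim: n v x Sx => [|n IHn] v x /=; first exact: p_reg.
move=> [c [x' [Cc Sx E]]].
have [t Ct Ec] := low_div Cc Sx Cp (esym E).
exists t, (x - t); split=> //; last by rewrite addrC subrK.
rewrite addrAC; apply: IHn; suff -> : p * (x - t) = x' by [].
by rewrite mulrBr E Ec addrC addKr.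
Qed.

Lemma spread_homogeneous v n x : spread v n x -> homogeneous D x.
Proof.
(* The offset is generalized to an integer multiple of [e], so that [C_in_D] places all components
   in the same coarse degree [v]. *)
move=> Sx; exists v; have : spread (v + e *~ 0) n x by rewrite mulr0z addr0.
move: 0 Sx => i _; elim: n i x => [|n IHn] i x /=.
  by move=> ->; apply: grading0.
move=> [c [x' [Cc Sx ->]]]; apply: (gradingD D_grading); first exact: C_in_D Cc.
by apply: (IHn (i + 1)); rewrite mulrzDr mulr1z addrA.
Qed.

Lemma homogeneous_spread x : homogeneous D x -> exists v n, spread v n x.
Proof. by move=> [w /D_spread[i [n Sx]]]; exists (w + e *~ i), n. Qed.

Lemma homogeneous_coarsen x : homogeneous C x -> homogeneous D x.
Proof. by move=> [v Cx]; apply/spread_homogeneous/(spread_hom 0 Cx). Qed.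

(* Gauss' lemma: p divides the lowest component a * b of x * y, hence divides a
   or b, which can then be removed from x or y. *)
Lemma prime_like_coarsen p :
  homogeneous C p -> prime_like C p -> prime_like D p.
Proof.
move=> [u Cp] pP x y.
move=> /homogeneous_spread[v [n Sx]] /homogeneous_spread[w [m Sy]].
elim: {n m}(n + m)%N {-2}n {-2}m (leqnn (n + m)) v w x y Sx Sy => [|k IHk] n m.
  rewrite leqn0 addn_eq0 => /andP[/eqP-> _] v w x y /= -> _ _.
  by left; exists 0; rewrite mulr0.
case: n => [|n] nmk v w x y Sx Sy.
  by rewrite Sx => _; left; exists 0; rewrite mulr0.
case: m nmk Sy => [|m] nmk Sy.
  by rewrite Sy => _; right; exists 0; rewrite mulr0.
have [a [x' [Ca Sx' Ex]]] := Sx; have [b [y' [Cb Sy' Ey]]] := Sy.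
move=> pxy; have pab : divides p (a * b).
  have [t Et] := pxy; pose z := a * y' + x' * y.
  have Exy : x * y = a * b + z by rewrite /z Ex Ey mulrDl mulrDr addrA.
  have Sz : spread (v + w + e) (n + m.+1) z.
    apply: spreadD.
      apply: (@spread_leq _ m); first by rewrite addnS ltnW // ltnS leq_addl.
      by rewrite -addrA; apply: spread_homM.
    by rewrite addrAC; apply: spreadM.
  have Cab : C (v + w) (a * b) by apply: gradingM.
  have [t' _ ->] := low_div Cab Sz Cp (etrans (esym Exy) Et).
  by exists t'.
have hom u' z : C u' z -> homogeneous C z by exists u'.
case: (pP a b (hom _ _ Ca) (hom _ _ Cb) pab) => [pa|pb].
  have /(IHk _ _ _ _ _ _ _ Sx' Sy)[] : divides p (x' * y).
  - have -> : x' * y = x * y - a * y by rewrite Ex mulrDl addrC addKr.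
    by apply: dividesB => //; apply: dividesMl.
  - by rewrite -ltnS -addSn.
  - by move=> px'; left; rewrite Ex; apply: dividesD.
  - by right.
have /(IHk _ _ _ _ _ _ _ Sx Sy')[] : divides p (x * y').
- have -> : x * y' = x * y - x * b by rewrite Ey mulrDr addrC addKr.
  by apply: dividesB => //; apply: dividesMr.
- by rewrite -ltnS -addnS.
- by left.
- by move=> py'; right; rewrite Ey; apply: dividesD.
Qed.

Lemma graded_prime_coarsen p : graded_prime C p -> graded_prime D p.
Proof.
move=> [hp p0 pU pP]; split=> //; first exact: homogeneous_coarsen.
exact: prime_like_coarsen.
Qed.

Hypothesis C_fact : const_factorial C.

(** Absence of homogeneous zero divisors means that 0 is [prime_like], so this is Gauss' lemma for
    [p = 0]. *)
Lemma coarsen_domain x y : homogeneous D x -> homogeneous D y ->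
  x <> 0 -> y <> 0 -> x * y <> 0.
Proof.
move=> hx hy x0 y0 xy0; have h0 : homogeneous C 0 by exists 0; apply: grading0.
have P0 : prime_like C 0.
  move=> a b ha hb /divides0 ab0; rewrite !divides0; apply: contrapT.
  by move=> /not_orP[a0 b0]; apply: (C_fact.1 a b ha hb).
have /(prime_like_coarsen h0 P0 hx hy) : divides 0 (x * y) by apply/divides0.
by rewrite !divides0; case.
Qed.

Lemma coarsen_reg a t : homogeneous D a -> a <> 0 -> a * t = 0 -> t = 0.
Proof.
move=> ha a0 at0; apply: contrapT => t0.
have [v Da] := ha.
have [t' [ht' t'0 E]] := grading_full D_grading Da at0 t0.
exact: (coarsen_domain ha ht').
Qed.

Lemma coarsen_can a x y : homogeneous D a -> a <> 0 -> a * x = a * y -> x = y.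
Proof.
move=> ha a0 E; apply/eqP; rewrite -subr_eq0; apply/eqP.
by apply: (coarsen_reg ha a0); rewrite mulrBr E subrr.
Qed.

Definition primitive (x : R) :=
  [/\ homogeneous D x, x <> 0 & forall p, graded_prime C p -> ~ divides p x].

Hypothesis R_nontriv : (1 : R) <> 0.

Lemma prime_associate p q : graded_prime C p -> graded_prime C q ->
  divides p q -> exists2 c, c != 0 & q = cst c * p.
Proof.
move=> [hp p0 pU pP] [hq q0 qU qP] [u0 E0].
have [u hu E] := homogeneous_div C_grading hp hq E0.
have [] : divides q p \/ divides q u.
- by apply: qP => //; rewrite -E; exists 1; rewrite mulr1.
- move=> [w Ew]; have u1 : u * w = 1.
    apply: (homogeneous_can C_grading C_fact hp p0).
    by rewrite mulrA -E -Ew mulr1.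
  have [c c0 Ec] := homogeneous_unit_cst C_fact R_nontriv hu (ex_intro _ w u1).
  by exists c => //; rewrite E Ec mulrC.
- move=> [w Ew]; case: pU; exists w.
  apply: (homogeneous_can C_grading C_fact hq q0).
  by rewrite mulr1 mulrCA -Ew -E.
Qed.

Lemma prime_dvd_prod p c s : graded_prime C p -> c != 0 ->
  (forall q, q \in s -> graded_prime C q) ->
  divides p (cst c * \prod_(q <- s) q) -> exists2 q, q \in s & divides p q.
Proof.
move=> [hp p0 pU pP] c0; elim: s => [|q s IHs] sP.
  rewrite big_nil mulr1 => pc.
  by case: pU; apply: divides_unit pc _; apply: is_unit_cst.
have sP' q' : q' \in s -> graded_prime C q'.
  by move=> q's; apply: sP; rewrite inE q's orbT.
rewrite big_cons mulrCA => pqs; have [] := pP q _ _ _ pqs.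
- by have [] := sP q (mem_head q s).
- apply: homogeneousM; [exact: C_grading|exact: homogeneous_cst|].
  by apply: homogeneous_prod => // q' /sP'[].
- by move=> pq; exists q; rewrite ?mem_head.
- by move=> /(IHs sP')[q' q's pq']; exists q'; rewrite // inE q's orbT.
Qed.

(** Primes of the finer grading are split off until none is left. This terminates because each of
    them uses up a prime factor of the lowest non-zero component. *)
Lemma content x : homogeneous D x -> x <> 0 ->
  exists a x', [/\ homogeneous C a, a <> 0, primitive x' & x = a * x'].
Proof.
move=> /homogeneous_spread[v [n]].
elim: n v x => [//|n IHn] v x Sx x0.
have [c [x' [Cc Sx' Ex]]] := Sx.
have [c0|c0] := EM (c = 0).
  by apply: (IHn (v + e)) => //; rewrite Ex c0 add0r.
have hc : homogeneous C c by exists v.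
have [b [s [b0 sP Ec]]] := C_fact.2 c hc c0.
(* A prime dividing x divides its lowest component c. *)
have [k] := ubnP (size s).
elim: k s => // k IHk s in sP b b0 c v x x' Cc Sx Sx' Ex Ec x0 {c0 hc} *.
move=> sk.
have [[p [pP px]]|noP] := EM (exists p, graded_prime C p /\ divides p x).
  have [[w Cp] p0 pU _] := pP; have [t Et] := px.
  have [t' Ct' Ec'] := low_div Cc Sx' Cp (etrans (esym Ex) Et).
  have hp : homogeneous C p by exists w.
  have [|q qs pq] := @prime_dvd_prod p b s pP b0 sP.
    by rewrite -Ec Ec'; exists t'.
  have [u u0 Eq] := prime_associate pP (sP q qs) pq.
  have t0 : t <> 0 by move=> t0; apply: x0; rewrite Et t0 mulr0.
  have p_reg z : p * z = 0 -> z = 0 := homogeneous_reg C_grading C_fact hp p0.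
  have Spt : spread v n.+1 (p * t) by rewrite -Et.
  have St := spread_div Cp Spt p_reg.
  have St' : spread (v - w + e) n (t - t').
    rewrite addrAC; apply: (spread_div Cp _ p_reg).
    by rewrite mulrBr -Et -Ec' Ex [c + _]addrC addrK.
  have remP q' : q' \in rem q s -> graded_prime C q'.
    by move=> /mem_rem /sP.
  have bu0 : b * u != 0 by rewrite mulf_neq0.
  have Ett' : t = t' + (t - t') by rewrite addrC subrK.
  (* Since [q] is [p] up to the constant [u], the new lowest component [t'] has the factorization of
     [c] with [q] removed. *)
  have Et' : t' = cst (b * u) * \prod_(q0 <- rem q s) q0.
    apply: (homogeneous_can C_grading C_fact hp p0); rewrite -Ec' Ec.
    rewrite (perm_big _ (perm_to_rem qs)) big_cons /= rmorphM.
    move: (\prod_(_ <- _) _) => Q; rewrite Eq; ring.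
  have rk : (size (rem q s) < k)%N.
    by rewrite -ltnS; apply: leq_trans sk; rewrite size_rem //; case: (s) qs.
  have [a [y [ha a0 yP Ey]]] :=
    IHk _ remP _ bu0 _ _ _ _ Ct' St St' Ett' Et' t0 rk.
  exists (p * a), y; split=> //.
  - exact: homogeneousM.
  - exact: (C_fact.1 p a).
  - by rewrite -mulrA -Ey.
exists 1, x; split; rewrite ?mul1r //.
- exact: homogeneous1.
- split=> //; first exact: spread_homogeneous Sx.
  by move=> p pP px; apply: noP; exists p.
Qed.

(** The prime factors of [c] stay prime in the coarser grading and do not divide the primitive [z].
    So they divide the cofactor of [z], and are cancelled one after the other. *)
Lemma primitive_dvd c z t : homogeneous C c -> c <> 0 -> primitive z ->
  homogeneous D t -> divides z (c * t) -> divides z t.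
Proof.
move=> hc c0 [hz z0 zP] ht.
have [b [s [b0 sP ->]]] := C_fact.2 c hc c0.
elim: s => [|p s IHs] in sP *.
  rewrite big_nil mulr1 => -[q Eq]; exists (cst b^-1 * q).
  by rewrite mulrCA -Eq mulrA -rmorphM mulVf // rmorph1 mul1r.
have sP' q : q \in s -> graded_prime C q.
  by move=> qs; apply: sP; rewrite inE qs orbT.
have pP := sP p (mem_head p s); have [hp p0 pU _] := pP.
rewrite big_cons => -[q0 E0].
have hs : homogeneous D (cst b * \prod_(q <- s) q).
  apply: homogeneousM; [exact: D_grading|exact: homogeneous_cst|].
  apply: homogeneous_prod => // q /sP'[hq _ _ _].
  exact: homogeneous_coarsen.
have hpst : homogeneous D (p * (cst b * \prod_(q <- s) q * t)).
  apply: homogeneousM => //; first exact: homogeneous_coarsen.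
  exact: homogeneousM.
have {}E0 : p * (cst b * \prod_(q <- s) q * t) = z * q0 by rewrite -E0; ring.
have [q hq E] := homogeneous_div D_grading hz hpst E0.
have [_ _ _ pD] := graded_prime_coarsen pP.
have [||[q' Eq']] := pD z q hz hq.
- by rewrite -E; exists (cst b * \prod_(q <- s) q * t).
- by move/(zP p pP).
- apply: (IHs sP'); exists q'.
  apply: (coarsen_can (homogeneous_coarsen hp) p0).
  by rewrite E Eq' mulrCA.
Qed.

Definition width_le n x := exists v, spread v n x.

(* Crosswise multiplication by the lowest components cancels the lowest component
   of t, so that its width decreases. *)
Lemma width_euclid (J : R -> Prop) n z :
  (forall a b x y, J x -> J y -> J (a * x - b * y)) ->
  (forall x, J x -> width_le n x -> x = 0) ->
  J z -> z <> 0 -> width_le n.+1 z ->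
  forall t, J t -> homogeneous D t ->
    exists c, [/\ homogeneous C c, c <> 0 & divides z (c * t)].
Proof.
move=> JP Jmin Jz z0 [v Sz] t Jt /homogeneous_spread[w [k]].
have [a [z' [Ca Sz' Ez]]] := Sz.
have a0 : a <> 0.
  move=> a0; apply: z0; apply: Jmin => //; exists (v + e).
  by rewrite Ez a0 add0r.
have ha : homogeneous C a by exists v.
elim: k t w Jt => [|k IHk] t w Jt St.
  exists 1; split=> //; first exact: homogeneous1.
  by rewrite St mulr0; exists 0; rewrite mulr0.
have [kn|nk] := ltnP k n.
  exists 1; split=> //; first exact: homogeneous1.
  rewrite (Jmin t Jt); first by rewrite mulr0; exists 0; rewrite mulr0.
  by exists w; apply: spread_leq St.
have [b [t' [Cb St' Et]]] := St.
have E : a * t - b * z = a * t' - b * z'.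
  by rewrite Et Ez !mulrDr (mulrC b a) opprD addrACA subrr add0r.
have S' : spread (v + w + e) k (a * t - b * z).
  rewrite E; apply: spreadB; first by rewrite -addrA; apply: spread_homM.
  rewrite (addrC v) -addrA; apply: spread_homM => //.
  exact: spread_leq Sz'.
have [c [hc c0 [q Eq]]] := IHk _ _ (JP a b t z Jt Jz) S'.
exists (c * a); split; [exact: homogeneousM|exact: (C_fact.1 c a)|].
exists (q + c * b); rewrite mulrDr -Eq; ring.
Qed.

Lemma primitive_dvd_primitive y z :
  primitive z -> homogeneous D y -> divides y z -> primitive y.
Proof.
move=> [hz z0 zP] hy yz; split=> //.
  by move=> y0; apply: z0; case: yz => t ->; rewrite y0 mul0r.
by move=> p pP /divides_trans/(_ yz)/(zP p pP).
Qed.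

Lemma primitive_C_unit x : primitive x -> homogeneous C x ->
  exists2 c, c != 0 & x = cst c.
Proof.
move=> [_ x0 xP] hx; have [c [[|p s] [c0 sP E]]] := C_fact.2 x hx x0.
  by exists c => //; rewrite E big_nil mulr1.
case: (xP p (sP p (mem_head p s))); rewrite E big_cons.
by apply/dividesMr/dividesMl; exists 1; rewrite mulr1.
Qed.

(** Let [t] be a non-zero element of least width in the ideal [J] of [z] and [y]. If [z] is as
    narrow as [t], pseudo-division by [z] gives that [z] divides [y]. Otherwise the primitive part
    of [t] divides [z] and is narrower, hence a unit by minimality of [z]; as [z] divides [t * v],
    it then divides [a * v] for the content [a] of [t], and so divides [v]. *)
Lemma minimal_divisor_prime n z : primitive z -> ~ is_unit z -> width_le n z ->
  (forall y k, primitive y -> divides y z -> ~ is_unit y -> width_le k y ->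
     (n <= k)%N) ->
  graded_prime D z.
Proof.
move=> zP zU wz zmin; have [hz z0 _] := zP; split=> // y v hy hv zyv.
pose J t := exists a b, t = a * z + b * y.
have Jz : J z by exists 1, 0; rewrite mul1r mul0r addr0.
have Jy : J y by exists 0, 1; rewrite mul1r mul0r add0r.
have JP a b x t : J x -> J t -> J (a * x - b * t).
  move=> [a1 [b1 ->]] [a2 [b2 ->]].
  by exists (a * a1 - b * a2), (a * b1 - b * b2); ring.
pose Q k := `[< exists t, [/\ J t, t <> 0 & width_le k t] >].
have exQ : exists k, Q k by exists n; apply/asboolP; exists z.
case: (ex_minnP exQ) => -[|k] /asboolP[t [Jt t0 wt]] kmin.
  by case: wt => u /= /t0.
have Jmin x : J x -> width_le k x -> x = 0.
  move=> Jx wx; apply: contrapT => x0; have : Q k by apply/asboolP; exists x.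
  by move/kmin; rewrite ltnn.
have [wzk|wzk] := EM (width_le k.+1 z).
  have [c [hc c0 d]] := width_euclid JP Jmin Jz z0 wzk Jy hy.
  by left; apply: primitive_dvd d.
have ht : homogeneous D t by case: wt => u /spread_homogeneous.
have [a [t' [ha a0 t'P Et]]] := content ht t0.
have ht' : homogeneous D t' by case: t'P.
have dvd x : divides t x -> divides t' x.
  by apply: divides_trans; exists a; rewrite Et mulrC.
have t'z : divides t' z.
  have [c [hc c0 /dvd d]] := width_euclid JP Jmin Jt t0 wt Jz hz.
  exact: primitive_dvd d.
have wt' : width_le k.+1 t'.
  have [va Ca] := ha; have [vt St] := wt; exists (vt - va).
  apply: (spread_div Ca); first by rewrite -Et.
  by move=> x; apply: (homogeneous_reg C_grading C_fact).
have [[u Eu]|t'U] := EM (is_unit t'); last first.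
  case: wzk; have [w Sz] := wz; exists w; apply: spread_leq Sz.
  exact: (zmin t').
right; apply: (@primitive_dvd a) => //.
have -> : a * v = t * v * u by rewrite Et mulrAC -(mulrA a) Eu mulr1.
apply: dividesMl; have [b1 [b2 ->]] := Jt; rewrite mulrDl.
apply: dividesD.
  by rewrite mulrAC; apply: dividesMr; exists 1; rewrite mulr1.
by rewrite -mulrA; apply: dividesMr.
Qed.

(** The width is chosen least possible; then neither end component is 0, since dropping it would
    shorten the expansion. *)
Lemma spread_ends w y : D w y -> y <> 0 ->
  exists i h b b' d d',
    [/\ C (w + e *~ i) b, b <> 0, spread (w + e *~ i + e) h b' & y = b + b'] /\
    [/\ C (w + e *~ i + e *+ h) d, d <> 0, spread (w + e *~ i) h d' &
        y = d' + d].
Proof.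
move=> /D_spread[i0 [n0 S0]] y0.
pose Q k := `[< exists i, spread (w + e *~ i) k y >].
have exQ : exists k, Q k by exists n0; apply/asboolP; exists i0.
case: (ex_minnP exQ) => -[|h] /asboolP[i S] hmin; first by case: y0.
have hP j : ~ spread (w + e *~ j) h y.
  move=> Sj; have /hmin : Q h by apply/asboolP; exists j.
  by rewrite ltnn.
have [b [b' [Cb Sb' Eb]]] := S; have [d [d' [Cd Sd' Ed]]] := spread_last S.
exists i, h, b, b', d, d'; split; split=> // z0.
  by apply: (hP (i + 1)); rewrite mulrzDr mulr1z addrA Eb z0 add0r.
by apply: (hP i); rewrite Ed z0 addr0.
Qed.

(** The end components of [z * y] are the products of those of [z] and [y], non-zero for lack of
    homogeneous zero divisors, so widths add as for Laurent polynomials. As [z] is not homogeneous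
    for the finer grading, it contributes at least one step. *)
Lemma cofactor_width t u z y j n : D t z -> D u y -> z <> 0 -> y <> 0 ->
  ~ homogeneous C z -> spread (t + u + e *~ j) n (z * y) ->
  exists i n', (n' < n)%N /\ spread (u + e *~ i) n' y.
Proof.
move=> Dz Dy z0 y0 zC Szy.
have [k [h [a [a' [c [c' [[Ca a0 Sa' Ea] [Cc c0 Sc' Ec]]]]]]]] :=
  spread_ends Dz z0.
have [i [m [b [b' [d [d' [[Cb b0 Sb' Eb] [Cd d0 Sd' Ed]]]]]]]] :=
  spread_ends Dy y0.
move: Ca Sa' Cc Sc' Cb Sb' Cd Sd'.
have Ev : t + u + e *~ (k + i) = (t + e *~ k) + (u + e *~ i).
  by rewrite mulrzDr addrACA.
set tz := t + e *~ k in Ev *; set uy := u + e *~ i in Ev *.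
move=> Ca Sa' Cc Sc' Cb Sb' Cd Sd'.
have h0 : (0 < h)%N.
  case: h {Cc} Sa' Sc' => [/= a'0|//] _.
  by case: zC; exists tz; rewrite Ea a'0 addr0.
exists i, m.+1; split; last by exists b, b'.
(* The given expansion is moved to the degree where the product really starts. It may begin earlier,
   with zero components; beginning later would make [a * b] vanish. *)
have Szy' : spread (tz + uy) n (z * y).
  have [ki|ki] := leP j (k + i).
    have [q Eq] : exists q : nat, k + i = j + q%:Z.
      exists (absz (k + i - j)%R).
      by rewrite gez0_abs ?subr_ge0 // [RHS]addrC subrK.
    have Ev' : t + u + e *~ j + e *+ q = tz + uy.
      by rewrite -Ev Eq mulrzDr pmulrn !addrA.
    rewrite -Ev'; apply: (spread_trunc (n' := h.+1 + m.+1)) => //.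
    by rewrite Ev'; apply: spreadM; [exists a, a' | exists b, b'].
  have [q Eq] : exists q : nat, j = k + i + q.+1%:Z.
    exists (absz (j - (k + i))%R).-1.
    rewrite prednK ?absz_gt0 ?subr_eq0 ?gt_eqF //.
    by rewrite gtz0_abs ?subr_gt0 // [RHS]addrC subrK.
  have Ev' : t + u + e *~ j = tz + uy + e + e *+ q.
    by rewrite -Ev Eq mulrzDr -pmulrn mulrS !addrA.
  have := Szy; rewrite Ev' => /spread_shift Szy'.
  case: (C_fact.1 a b _ _ a0 b0); [by exists tz|by exists uy|].
  apply: (@low_eq0 (tz + uy) (maxn (h + m.+1) (maxn m (q + n))) _
            (a' * y + a * b' - z * y)).
  - exact: gradingM.
  - apply: spreadB; first apply: spreadD.
    + apply: (@spread_leq _ (h + m.+1)); first exact: leq_maxl.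
      by rewrite addrAC; apply: spreadM => //; exists b, b'.
    + apply: (@spread_leq _ m); first by rewrite !leq_max leqnn orbT.
      by rewrite -addrA; apply: spread_homM.
    + by apply: spread_leq Szy'; rewrite !leq_max leqnn !orbT.
  - by rewrite Ea Eb; ring.
have [//|nhm] := leqP n (h + m); last first.
  by apply: leq_trans nhm; rewrite ltnS -add1n leq_add2r.
(* With [n] at most [h + m], the highest component [c * d] would lie beyond the expansion and
   vanish. *)
move=> nhm; case: (C_fact.1 c d _ _ c0 d0);
  [by exists (tz + e *+ h)|by exists (uy + e *+ m)|].
apply: (@spread_top_eq0 (tz + uy) (h + m)); last first.
  by rewrite mulrnDr addrACA; apply: gradingM.
have -> : c * d = z * y - c' * d' - (c' * d + c * d') by rewrite Ec Ed; ring.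
apply: spreadB; first apply: spreadB.
- exact: spread_leq Szy'.
- exact: spreadM.
apply: spreadD.
  rewrite addnC; apply: spread_shift; rewrite -addrA addrC mulrC.
  exact: spread_homM.
by apply: spread_shift; rewrite addrAC; apply: spread_homM.
Qed.

(** The product with the inverse is 1, of width 1. If [x] were not homogeneous for the finer
    grading, [cofactor_width] would leave width 0 for its inverse. *)
Lemma primitive_unit x : primitive x -> is_unit x ->
  exists2 c, c != 0 & x = cst c.
Proof.
move=> xP [y0 E0]; have [[w Dx] x0 _] := xP.
have [y Dy E] := grading_div D_grading Dx (grading1 D_grading) (esym E0).
apply: primitive_C_unit => //; apply: contrapT => xC.
have y_neq0 : y <> 0 by move=> y00; apply: R_nontriv; rewrite E y00 mulr0.
have S1 : spread (w + (0 - w) + e *~ 0) 1 (x * y).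
  rewrite -E mulr0z addr0 addrC subrK; apply: spread_hom.
  exact: grading1.
have [i [[|n'] [//]]] := cofactor_width Dx Dy x0 y_neq0 xC S1.
Qed.

(** Induction on the width. A primitive non-unit divisor of least width is prime; were it
    homogeneous for [C], it would be a constant, so [cofactor_width] makes the cofactor narrower. *)
Lemma primitive_factor n w i x : primitive x -> D w x ->
  spread (w + e *~ i) n x ->
  exists c s, [/\ c != 0, forall p, p \in s -> graded_prime D p &
                  x = cst c * \prod_(p <- s) p].
Proof.
have [N] := ubnP n; elim: N n w i x => // N IHN n w i x nN xP Dx Sx.
have [xU|xU] := EM (is_unit x).
  have [c c0 E] := primitive_unit xP xU.
  by exists c, [::]; rewrite big_nil mulr1.
pose Q k := `[< exists y,
  [/\ primitive y, divides y x, ~ is_unit y & width_le k y] >].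
have exQ : exists k, Q k.
  exists n; apply/asboolP; exists x; split=> //; last by exists (w + e *~ i).
  by exists 1; rewrite mulr1.
case: (ex_minnP exQ) => k /asboolP[z [zP zx zU wz]] kmin.
have zprime : graded_prime D z.
  apply: (minimal_divisor_prime zP zU wz) => y k' yP yz yU wy.
  apply: kmin; apply/asboolP; exists y; split=> //.
  exact: divides_trans zx.
have [t Dz] : homogeneous D z by case: zP.
have [x1_ E0] := zx.
have [x1 Dx1 E] := grading_div D_grading Dz Dx E0.
have z0 : z <> 0 by case: zP.
have x0 : x <> 0 by case: xP.
have x10 : x1 <> 0 by move=> x10; apply: x0; rewrite E x10 mulr0.
have x1P : primitive x1.
  apply: primitive_dvd_primitive xP _ _; first by exists (w - t).
  by exists z; rewrite E mulrC.
have zC : ~ homogeneous C z.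
  move=> /(primitive_C_unit zP)[c c0 Ez]; apply: zU.
  by rewrite Ez; apply: is_unit_cst.
have Szx : spread (t + (w - t) + e *~ i) n (z * x1).
  by rewrite -E [t + _]addrC subrK.
have [i' [n' [n'n Sx1]]] := cofactor_width Dz Dx1 z0 x10 zC Szx.
have n'N : (n' < N)%N by apply: leq_trans n'n _; rewrite -ltnS.
have [c [s [c0 sP Ex1]]] := IHN _ _ _ _ n'N x1P Dx1 Sx1.
exists c, (z :: s); split=> //; last by rewrite big_cons mulrCA -Ex1.
by move=> p; rewrite inE => /orP[/eqP->//|/sP].
Qed.

Lemma const_factorial_coarsen : const_factorial D.
Proof.
split=> [|x hx x0]; first exact: coarsen_domain.
have [a [x' [ha a0 x'P E]]] := content hx x0.
have [c [s [c0 sP Ea]]] := C_fact.2 a ha a0.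
have [[w Dx'] _ _] := x'P; have [i [n Sx']] := D_spread Dx'.
have [c' [s' [c'0 s'P Ex']]] := primitive_factor x'P Dx' Sx'.
exists (c * c'), (s ++ s'); split; first by rewrite mulf_neq0.
  by move=> p; rewrite mem_cat => /orP[/sP/graded_prime_coarsen|/s'P].
by rewrite E Ea Ex' big_cat rmorphM mulrACA.
Qed.

End Coarsening.
End Homogeneous.

(** * Gradings of quotients of polynomial rings *)

Section MonomialParts.
Variables (F : fieldType) (N : nat).

Definition mdegree (u : 'X_{1..N}) : 'cV[int]_N := \col_i (u i)%:Z.

Lemma mdegreeD u v : mdegree (u + v)%MM = mdegree u + mdegree v.
Proof. by apply/matrixP=> i j; rewrite !mxE mnmDE PoszD. Qed.

Lemma mdegree0 : mdegree 0%MM = 0.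
Proof. by apply/matrixP=> i j; rewrite !mxE mnmE. Qed.

Definition mpart (T : pred 'X_{1..N}) (p : {mpoly F[N]}) : {mpoly F[N]} :=
  \sum_(u <- msupp p | T u) p@_u *: 'X_[u].

Lemma mcoeff_mpart T p u : (mpart T p)@_u = if T u then p@_u else 0.
Proof.
rewrite /mpart raddf_sum /=.
have [up|up] := boolP (u \in msupp p); last first.
  rewrite big1_seq ?memN_msupp_eq0 ?if_same // => v /andP[_ vp].
  rewrite mcoeffZ mcoeffX; case: eqP => [E|]; last by rewrite mulr0.
  by rewrite E (negPf up) in vp.
rewrite big_mkcond (bigD1_seq u) //= mcoeffZ mcoeffX eqxx mulr1.
rewrite big1 ?addr0 // => v vu; case: (T v) => //.
by rewrite mcoeffZ mcoeffX (negPf vu) mulr0.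
Qed.

Lemma mpart_is_additive T : additive (mpart T).
Proof.
move=> p q; apply/mpolyP => u; rewrite mcoeffB !mcoeff_mpart mcoeffB.
by case: (T u); rewrite ?subr0.
Qed.

HB.instance Definition _ T :=
  GRing.isAdditive.Build _ _ (mpart T) (mpart_is_additive T).

Lemma mem_msupp_mpart (T : pred _) p u :
  (u \in msupp (mpart T p)) = T u && (u \in msupp p).
Proof. by rewrite !mcoeff_msupp mcoeff_mpart; case: (T u); rewrite ?eqxx. Qed.

Lemma mpart_id (T : pred _) p : {in msupp p, forall u, T u} -> mpart T p = p.
Proof.
move=> Tp; apply/mpolyP => u; rewrite mcoeff_mpart; case: ifPn => // Tu.
by rewrite memN_msupp_eq0 //; apply: contra Tu => /Tp.
Qed.

Lemma mpart_eq0 (T : pred _) p : {in msupp p, forall u, ~~ T u} -> mpart T p = 0.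
Proof.
move=> Tp; apply/mpolyP => u; rewrite mcoeff_mpart mcoeff0; case: ifPn => // Tu.
by rewrite memN_msupp_eq0 //; apply: contraL Tu => /Tp.
Qed.

End MonomialParts.

Section Lattice.
Variables (F : fieldType) (N : nat) (L : 'cV[int]_N -> Prop).
Hypotheses (L0 : L 0) (LB : forall x y, L x -> L y -> L (x - y)).

Lemma latticeN x : L x -> L (- x).
Proof. by move=> Lx; rewrite -sub0r; apply: LB. Qed.

Lemma latticeD x y : L x -> L y -> L (x + y).
Proof. by move=> Lx Ly; rewrite -[y]opprK; apply: LB => //; apply: latticeN. Qed.

Definition mhomog (w : 'cV[int]_N) (p : {mpoly F[N]}) : Prop :=
  {in msupp p, forall u, L (mdegree u - w)}.

Definition hpart (w : 'cV[int]_N) : {mpoly F[N]} -> {mpoly F[N]} :=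
  mpart (fun u => `[< L (mdegree u - w) >]).

Lemma hpart_is_additive w : additive (hpart w).
Proof. by move=> p q; rewrite /hpart raddfB. Qed.

HB.instance Definition _ w :=
  GRing.isAdditive.Build _ _ (hpart w) (hpart_is_additive w).

Lemma mhomog0 w : mhomog w 0.
Proof. by move=> u; rewrite msupp0. Qed.

Lemma mhomogB w p q : mhomog w p -> mhomog w q -> mhomog w (p - q).
Proof. by move=> hp hq u /msuppB_le; rewrite mem_cat => /orP[/hp|/hq]. Qed.

Lemma mhomogD w p q : mhomog w p -> mhomog w q -> mhomog w (p + q).
Proof. by move=> hp hq u /msuppD_le; rewrite mem_cat => /orP[/hp|/hq]. Qed.

Lemma mhomogM v w p q : mhomog v p -> mhomog w q -> mhomog (v + w) (p * q).
Proof.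
move=> hp hq u /msuppM_le/allpairsP[[a b] /= [ap bq ->]].
rewrite mdegreeD opprD addrACA; apply: latticeD; [exact: hp|exact: hq].
Qed.

Lemma mhomogX w u : L (mdegree u - w) -> mhomog w 'X_[u].
Proof. by move=> Lu v; rewrite msuppX inE => /eqP->. Qed.

Lemma mhomogZ w c p : mhomog w p -> mhomog w (c *: p).
Proof. by move=> hp u /msuppZ_le/hp. Qed.

Lemma mhomogC c : mhomog 0 c%:MP.
Proof.
move=> u; rewrite msuppC; case: (c == 0); rewrite // inE => /eqP->.
by rewrite mdegree0 subr0.
Qed.

Lemma hpart_mhomog w p : mhomog w (hpart w p).
Proof. by move=> u; rewrite mem_msupp_mpart => /andP[/asboolP]. Qed.

Lemma hpart_id w p : mhomog w p -> hpart w p = p.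
Proof. by move=> hp; apply: mpart_id => u /hp Lu; apply/asboolP. Qed.

(** After splitting [p] into its part of degree [w - v] and the rest, no product of monomials of [q]
    and of the rest has degree [w]. *)
Lemma hpartM v w p q : mhomog v q -> hpart w (q * p) = q * hpart (w - v) p.
Proof.
move=> hq; rewrite -{1}[p](subrK (hpart (w - v) p)) mulrDr raddfD /=.
rewrite [X in X + _](_ : _ = 0) ?add0r.
  apply: hpart_id; rewrite -[w](subrK v) addrC.
  by apply: mhomogM => //; rewrite addrC addrK; apply: hpart_mhomog.
apply: mpart_eq0 => u /msuppM_le/allpairsP[[b a] /= [/hq Lb ap ->]].
apply/asboolP; rewrite mdegreeD => Lab.
have La : L (mdegree a - (w - v)).
  have -> : mdegree a - (w - v) = mdegree b + mdegree a - w - (mdegree b - v).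
    by apply/matrixP => i j; rewrite !mxE; ring.
  exact: LB.
move: ap; rewrite mcoeff_msupp mcoeffB mcoeff_mpart.
by move/asboolP: La => ->; rewrite subrr eqxx.
Qed.

Variables (k : nat) (g : 'I_k -> {mpoly F[N]}).
Hypothesis g_homog : forall i, exists v, mhomog v (g i).

Lemma hpart_ideal w p : p \in gen_ideal g -> hpart w p \in gen_ideal g.
Proof.
move=> /asboolP[c ->]; apply/asboolP.
have /choice[v hv] := g_homog.
exists (fun i => hpart (w - v i) (c i)).
rewrite raddf_sum /=; apply: eq_bigr => i _.
by rewrite ![_ * g i]mulrC; apply: hpartM.
Qed.

(** Degrees are given by representing vectors rather than by classes modulo [L], so that the
    gradings of a whole chain of lattices share one index group. Vectors congruent modulo [L] name
    the same component. *)
Definition qcomp (w : 'cV[int]_N) (x : quot_ring g) : Prop :=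
  exists2 p, mhomog w p & x = qclass g p.

Definition qcst : {rmorphism F -> quot_ring g} :=
  qclass g \o @mpolyC N F.

Lemma qclass_eq0 p : (qclass g p = 0) <-> p \in gen_ideal g.
Proof.
rewrite -(rmorph0 (qclass g)); split=> [/qclassP|pI]; first by rewrite subr0.
by apply/qclassP; rewrite subr0.
Qed.

Lemma qcomp_grading : grading qcst qcomp.
Proof.
split.
- by move=> w; exists 0; rewrite ?rmorph0 //; apply: mhomog0.
- move=> w _ _ [p hp ->] [q hq ->]; exists (p - q); last by rewrite rmorphB.
  exact: mhomogB.
- move=> v w _ _ [p hp ->] [q hq ->]; exists (p * q); last by rewrite rmorphM.
  exact: mhomogM.
- by move=> a; exists a%:MP => //; apply: mhomogC.
- move=> v w _ _ t [p hp ->] [q hq ->]; rewrite -[t]qclass_repr -rmorphM.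
  move: (repr t) => {}t /qclassP/(hpart_ideal w).
  rewrite raddfB /= (hpartM _ _ hp) hpart_id // => I.
  exists (qclass g (hpart (w - v) t)).
    by exists (hpart (w - v) t) => //; apply: hpart_mhomog.
  by rewrite -rmorphM; apply/qclassP.
- move=> v _ t [a ha ->]; rewrite -[t]qclass_repr -rmorphM.
  move: (repr t) => {t} p /qclass_eq0.
  (* Multiplication by [a] kills every homogeneous part of [p] in the quotient. If the part
     containing the leading monomial is itself 0 there, it is removed, and fewer monomials
     remain. *)
  have [n] := ubnP (size (msupp p)); elim: n p => // n IHn p pn apI p0.
  have [pz|pnz] := eqVneq p 0; first by rewrite pz rmorph0 in p0.
  have partI w : a * hpart w p \in gen_ideal g.
    have := hpart_ideal (w + v) apI.
    by rewrite (hpartM _ _ ha) addrK.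
  pose w := mdegree (mlead p).
  have [qI|qI] := EM (qclass g (hpart w p) = 0); last first.
    exists (qclass g (hpart w p)); split=> //.
      by exists w, (hpart w p) => //; apply: hpart_mhomog.
    by rewrite -rmorphM; apply/qclass_eq0.
  have sq : (size (msupp (p - hpart w p)) < n)%N.
    rewrite -ltnS; apply: leq_trans pn; rewrite ltnS.
    have lp := mlead_supp pnz.
    have -> : size (msupp p) = (size (rem (mlead p) (msupp p))).+1.
      by rewrite size_rem // prednK //; case: (msupp p) lp.
    rewrite ltnS; apply: uniq_leq_size => // u up.
    rewrite mem_rem_uniq // inE; apply/andP; split.
      apply: contraL up => /eqP->; rewrite mcoeff_msupp mcoeffB mcoeff_mpart.
      by rewrite -/w subrr asboolT // subrr eqxx.
    apply: contraLR up; rewrite !mcoeff_msupp !negbK mcoeffB mcoeff_mpart.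
    by move=> /eqP->; rewrite if_same subr0.
  apply: (IHn (p - hpart w p)) => //; first by rewrite mulrBr rpredB.
  by rewrite rmorphB /= qI subr0.
Qed.

End Lattice.

Arguments qcomp {F N} L {k} g w x.

Section Refinement.
Variables (F : fieldType) (N : nat) (L L' : 'cV[int]_N -> Prop).
Variables (k : nat) (g : 'I_k -> {mpoly F[N]}) (e : 'cV[int]_N).
Hypotheses (L0 : L 0) (LB : forall x y, L x -> L y -> L (x - y)).
Hypothesis g_homog : forall i, exists v, mhomog L v (g i).
Hypothesis L'P : forall x, L' x <-> exists i : int, L (x - e *~ i).
Hypothesis e_free : forall i : int, L (e *~ i) -> i = 0.

Lemma sub_lattice x : L x -> L' x.
Proof. by move=> Lx; apply/L'P; exists 0; rewrite mulr0z subr0. Qed.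

Lemma mhomog_sub w (p : {mpoly F[N]}) : mhomog L w p -> mhomog L' w p.
Proof. by move=> hp u /hp/sub_lattice. Qed.

Lemma lattice0 : L' 0.
Proof. exact: sub_lattice. Qed.

Lemma latticeB x y : L' x -> L' y -> L' (x - y).
Proof.
move=> /L'P[i Li] /L'P[j Lj]; apply/L'P; exists (i - j).
have -> : x - y - e *~ (i - j) = x - e *~ i - (y - e *~ j).
  by rewrite mulrzBr !opprD !opprK addrACA.
exact: LB.
Qed.

Lemma qcomp_sub w i x : qcomp L g (w + e *~ i) x -> qcomp L' g w x.
Proof.
move=> [p hp ->]; exists p => // u /hp Lu; apply/L'P; exists i.
by rewrite -addrA -opprD.
Qed.

Lemma spread_monomials v n x : spread (qcomp L g) e v n x ->
  exists2 p, x = qclass g p &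
    {in msupp p, forall u, exists j : nat, L (mdegree u - (v + e *+ j))}.
Proof.
elim: n v x => [|n IHn] v x /=.
  by move=> ->; exists 0; rewrite ?rmorph0 // => u; rewrite msupp0.
move=> [_ [x' [[c hc ->] /IHn[p -> hp] ->]]].
exists (c + p); first by rewrite rmorphD.
move=> u /msuppD_le; rewrite mem_cat => /orP[/hc Lu|/hp[j Lu]].
  by exists 0; rewrite addr0.
by exists j.+1; rewrite mulrS addrA.
Qed.

(** The identity is lifted to polynomials and projected to degree [v]. The terms of [b] disappear,
    since no positive multiple of [e] lies in [L]. *)
Lemma qcomp_low_div v w n c x p t : qcomp L g v c ->
  spread (qcomp L g) e (v + e) n x -> qcomp L g w p -> c + x = p * t ->
  exists2 t', qcomp L g (v - w) t' & c = p * t'.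
Proof.
move=> [a ha ->] /spread_monomials[b -> hb] [q hq ->].
rewrite -[t]qclass_repr -rmorphM -rmorphD; move: (repr t) => {}t.
move=> /qclassP/(hpart_ideal L0 LB g_homog v).
rewrite raddfB raddfD /= (hpartM L0 LB _ _ hq).
rewrite (hpart_id ha) [hpart _ _ b]mpart_eq0; last first.
  move=> u /hb[j Lj]; apply/asboolP => Lv.
  have /e_free : L (e *~ j.+1).
    have -> : e *~ j.+1 = mdegree u - v - (mdegree u - (v + e + e *+ j)).
      by apply/matrixP => i i'; rewrite -pmulrn mulrS !mxE; ring.
    exact: LB.
  by [].
rewrite addr0 => I; exists (qclass g (hpart L (v - w) t)).
  by exists (hpart L (v - w) t) => //; apply: hpart_mhomog.
by rewrite -rmorphM; apply/qclassP.
Qed.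

Lemma qcomp_spread w x : qcomp L' g w x ->
  exists i n, spread (qcomp L g) e (w + e *~ i) n x.
Proof.
have G := qcomp_grading L0 LB g_homog.
move=> [p hp ->]; rewrite [p]mpolyE rmorph_sum /=.
rewrite big_seq; elim/big_ind: _ => [|x1 x2 [i1 [n1 S1]] [i2 [n2 S2]]|u up].
- by exists 0, 0%N.
(* The summands may start in different degrees; the later expansion is padded with zeros down to the
   start of the earlier one. *)
- have shift i i' n y : i <= i' -> spread (qcomp L g) e (w + e *~ i') n y ->
      exists n', spread (qcomp L g) e (w + e *~ i) n' y.
    move=> ii' S; exists (absz (i' - i)%R + n)%N; apply: (spread_shift G).
    rewrite pmulrn gez0_abs ?subr_ge0 // -addrA -mulrzDr [i + _]addrC subrK.
    by [].
  have add i n n' y y' : spread (qcomp L g) e (w + e *~ i) n y ->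
      spread (qcomp L g) e (w + e *~ i) n' y' ->
      spread (qcomp L g) e (w + e *~ i) (n + n') (y + y').
    move=> S S'; apply: (spreadD G).
      by apply: (spread_leq G) S; apply: leq_addr.
    by apply: (spread_leq G) S'; apply: leq_addl.
  have [i12|i21] := leP i1 i2.
    have [n' S2'] := shift _ _ _ _ i12 S2.
    by exists i1, (n1 + n')%N; apply: add.
  have [n' S1'] := shift _ _ _ _ (ltW i21) S1.
  by exists i2, (n' + n2)%N; apply: add.
- have /L'P[i Li] := hp u up; exists i, 1%N; apply: (spread_hom e G 0).
  exists (p@_u *: 'X_[u]) => //; apply: mhomogZ; apply: mhomogX.
  by rewrite opprD addrA.
Qed.

Lemma refinement_factorial : (1 : quot_ring g) <> 0 ->
  const_factorial (qcst g) (qcomp L g) -> const_factorial (qcst g) (qcomp L' g).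
Proof.
move=> nz; have G := qcomp_grading L0 LB g_homog.
have G' : grading (qcst g) (qcomp L' g).
  apply: (qcomp_grading lattice0 latticeB) => i.
  by have [v hv] := g_homog i; exists v; apply: mhomog_sub.
move=> fact; apply: (const_factorial_coarsen G G' qcomp_sub qcomp_spread) fact nz.
exact: qcomp_low_div.
Qed.

Lemma refinement_prime p :
  graded_prime (qcomp L g) p -> graded_prime (qcomp L' g) p.
Proof.
have G := qcomp_grading L0 LB g_homog.
have G' : grading (qcst g) (qcomp L' g).
  apply: (qcomp_grading lattice0 latticeB) => i.
  by have [v hv] := g_homog i; exists v; apply: mhomog_sub.
exact: (graded_prime_coarsen G G' qcomp_sub qcomp_spread qcomp_low_div).
Qed.

End Refinement.

(** * The finest grading *)

Lemma closed_nth_root (F : closedFieldType) (n : nat) (c : F) :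
  (0 < n)%N -> exists x, x ^+ n = c.
Proof.
case: n => // n _.
have [x Ex] := solve_monicpoly (fun i => if i == 0%N then c else 0) (ltn0Sn n).
exists x; rewrite Ex big_ord_recl /= mulr1 big1 ?addr0 // => i _.
by rewrite mul0r.
Qed.

Lemma seq_min (T : eqType) (s : seq T) (f : T -> int) : s != [::] ->
  exists2 x, x \in s & {in s, forall y, f x <= f y}.
Proof.
elim: s => // x [|x' s] IHs _.
  by exists x; rewrite ?mem_head // => y; rewrite inE => /eqP->.
have [//|y ys ymin] := IHs.
have [xy|yx] := leP (f x) (f y).
  exists x; rewrite ?mem_head // => t; rewrite inE => /orP[/eqP->//|/ymin].
  exact: le_trans.
exists y; first by rewrite inE ys orbT.
by move=> t; rewrite inE => /orP[/eqP->|/ymin//]; apply: ltW.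
Qed.

Section QuotientPoints.
Variables (F : fieldType) (N k : nat) (g : 'I_k -> {mpoly F[N]}).
Variable th : 'I_N -> F.
Hypothesis th_g : forall i, (g i).@[th] = 0.

Definition qeval (x : quot_ring g) : F := (repr x).@[th].

Lemma qeval_class p : qeval (qclass g p) = p.@[th].
Proof.
have /qclassP/asboolP[c E] : qclass g (repr (qclass g p)) = qclass g p.
  exact: qclass_repr.
apply/eqP; rewrite -subr_eq0 -mevalB E raddf_sum big1 //= => i _.
by rewrite mevalM th_g mulr0.
Qed.

Lemma qevalM x y : qeval (x * y) = qeval x * qeval y.
Proof.
by rewrite -[x]qclass_repr -[y]qclass_repr -rmorphM !qeval_class mevalM.
Qed.

Lemma qevalD x y : qeval (x + y) = qeval x + qeval y.
Proof.
by rewrite -[x]qclass_repr -[y]qclass_repr -rmorphD !qeval_class mevalD.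
Qed.

Lemma qeval_cst c : qeval (qcst g c) = c.
Proof. by rewrite qeval_class mevalC. Qed.

Lemma qeval0 : qeval 0 = 0.
Proof. by rewrite -(rmorph0 (qcst g)) qeval_cst. Qed.

Lemma qeval1 : qeval 1 = 1.
Proof. by rewrite -(rmorph1 (qcst g)) qeval_cst. Qed.

Lemma qeval_prod (s : seq (quot_ring g)) :
  qeval (\prod_(q <- s) q) = \prod_(q <- s) qeval q.
Proof. by apply: big_morph; [exact: qevalM|exact: qeval1]. Qed.

End QuotientPoints.

(** * Quotients in which the block monomials form a pencil *)

Section PencilQuotient.
Variables (F : closedFieldType) (N r : nat) (r_gt0 : (0 < r)%N).
Variables (blk : 'I_N -> option 'I_r.+1) (lv : 'I_N -> nat).
Variables (a0 a1 : 'I_r.+1 -> F).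
Hypothesis lv_gt0 : forall v k, blk v = Some k -> (0 < lv v)%N.
Hypothesis blk_nonempty : forall k, k != ord0 -> exists v, blk v = Some k.
Hypothesis a_indep : forall i j, i != j -> a0 i * a1 j - a0 j * a1 i != 0.

Definition ymon (k : 'I_r.+1) : 'X_{1..N} :=
  [multinom (if blk j == Some k then lv j else 0%N) | j < N].

Variables (ng : nat) (g : 'I_ng -> {mpoly F[N]}).
(** Together with [class_y], this describes the relations without fixing their shape: block
    monomials become linear forms in two elements, and every point with this property satisfies the
    relations. *)
Hypothesis g_points : forall (th : 'I_N -> F) u0 u1,
  (forall k, \prod_j th j ^+ ymon k j = a0 k * u0 + a1 k * u1) ->
  forall i, (g i).@[th] = 0.
Variables z0 z1 : quot_ring g.
Hypothesis class_y : forall k,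
  qclass g 'X_[ymon k] = qcst g (a0 k) * z0 + qcst g (a1 k) * z1.

Definition lin (x : F * F) : quot_ring g :=
  qcst g x.1 * z0 + qcst g x.2 * z1.

(* The factor mu is needed when block ord0 is empty: its monomial 1 then forces
   the value 1 on the corresponding linear form. *)
Lemma exists_point (u0 u1 : F) (D : pred 'I_N) :
  (forall k, (a0 k * u0 + a1 k * u1 == 0) =
             [exists v, (blk v == Some k) && D v]) ->
  exists mu th, [/\ mu != 0, forall v, (th v == 0) = D v &
    forall k, \prod_j th j ^+ ymon k j = a0 k * (mu * u0) + a1 k * (mu * u1)].
Proof.
move=> uD; pose ell k := a0 k * u0 + a1 k * u1.
pose mu := if [exists v, blk v == Some ord0] then 1 else (ell ord0)^-1.
have mu0 : mu != 0.
  rewrite /mu; case: ifPn; rewrite ?oner_eq0 // => /existsPn b0.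
  rewrite invr_eq0 uD; apply/existsPn => v; rewrite negb_and.
  by rewrite b0.
have /choice[rt rtP] (v : 'I_N) : exists x : F, forall k, blk v = Some k ->
    x ^+ lv v = mu * ell k.
  case E: (blk v) => [k|]; last by exists 0.
  have [x Ex] := closed_nth_root (mu * ell k) (lv_gt0 E).
  by exists x => k' [<-].
pose rep k := [pick w | blk w == Some k].
have repP k : if rep k is Some w then blk w = Some k else
    forall w, blk w != Some k.
  rewrite /rep; case: pickP => [w /eqP//|none w].
  by rewrite none.
(* In a block whose form is non-zero, one chosen variable carries a root of the required value and
   the others are 1. In a block whose form is 0, some variable belongs to [D] and makes the product
   vanish. *)
pose th v := if D v then 0 else
  if blk v is Some k then
    if (ell k != 0) && (rep k == Some v) then rt v else 1
  else 1.
exists mu, th; split=> // [v|k].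
  rewrite /th; case: (D v); rewrite ?eqxx //.
  case E: (blk v) => [k|]; last by rewrite oner_eq0.
  case: ifPn => [/andP[ek _]|_]; last by rewrite oner_eq0.
  apply/negbTE/negP => /eqP rt0; move: (rtP v k E).
  rewrite rt0 expr0n eqn0Ngt (lv_gt0 E) /= => /esym/eqP.
  by rewrite mulf_eq0 (negPf mu0) (negPf ek).
rewrite !mulrA ![_ * mu]mulrC -!mulrA -mulrDr -/(ell k).
have thE j : th j ^+ ymon k j = if blk j == Some k then th j ^+ lv j else 1.
  by rewrite mnmE; case: ifP.
under eq_bigr do rewrite thE.
have [ek|ek] := eqVneq (ell k) 0.
  have := uD k; rewrite -/(ell k) ek eqxx mulr0 => /esym/existsP[v /andP[bv Dv]].
  rewrite (bigD1 v) //= bv /th Dv expr0n.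
  by rewrite eqn0Ngt (lv_gt0 (eqP bv)) mul0r.
have Dk v : blk v = Some k -> D v = false.
  move=> bv; have := uD k; rewrite -/(ell k) (negPf ek) => /esym/negbT/existsPn.
  by move=> /(_ v); rewrite bv eqxx /= => /negbTE.
move: (repP k); case Ek: (rep k) => [w|] bw; last first.
  have k0 : k = ord0.
    apply/eqP/negPn/negP => /blk_nonempty[v /eqP].
    by rewrite (negPf (bw v)).
  rewrite big1; last by move=> j _; rewrite (negPf (bw j)).
  rewrite /mu; case: ifPn => [/existsP[v]|_]; first by rewrite -k0 (negPf (bw v)).
  by rewrite -k0 mulVf.
rewrite (bigD1 w) //= bw eqxx {1}/th (Dk _ bw) bw ek Ek eqxx /=.
rewrite (rtP _ _ bw) big1 ?mulr1 // => j jw.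
case: ifP => // /eqP bj; rewrite /th (Dk _ bj) bj ek Ek /=.
case: eqP; rewrite ?expr1n // => -[wj].
by rewrite wj eqxx in jw.
Qed.

(* The linear form x is not proportional to any of the forms (a0 k, a1 k). *)
Definition nonspecial (x : F * F) := forall k, x.1 * a1 k - x.2 * a0 k != 0.

Definition atom (q : quot_ring g) : Prop :=
  (exists v, q = qclass g 'X_v) \/ (exists2 x, nonspecial x & q = lin x).

Lemma exists_other (k : 'I_r.+1) : exists j : 'I_r.+1, k != j.
Proof.
have [->|k0] := eqVneq k ord0; last by exists ord0.
by exists (Ordinal (r_gt0 : (1 < r.+1)%N)).
Qed.

Lemma pencil_unique u0 u1 w0 w1 :
  (forall k, a0 k * u0 + a1 k * u1 = a0 k * w0 + a1 k * w1) ->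
  u0 = w0 /\ u1 = w1.
Proof.
move=> E; have [j ij] := exists_other ord0.
have Ei := E ord0; have Ej := E j; have D0 := a_indep ij.
have solve (x y : F) : (a0 ord0 * a1 j - a0 j * a1 ord0) * (x - y) = 0 -> x = y.
  by move/eqP; rewrite mulf_eq0 (negPf D0) subr_eq0 => /eqP.
split; apply: solve.
  transitivity (a1 j * (a0 ord0 * u0 + a1 ord0 * u1 - (a0 ord0 * w0 + a1 ord0 * w1))
    - a1 ord0 * (a0 j * u0 + a1 j * u1 - (a0 j * w0 + a1 j * w1))); first by ring.
  by rewrite Ei Ej !subrr !mulr0 subrr.
transitivity (a0 ord0 * (a0 j * u0 + a1 j * u1 - (a0 j * w0 + a1 j * w1))
  - a0 j * (a0 ord0 * u0 + a1 ord0 * u1 - (a0 ord0 * w0 + a1 ord0 * w1))).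
  by ring.
by rewrite Ei Ej !subrr !mulr0 subrr.
Qed.

Lemma qeval_lin th u0 u1 x :
  (forall k, \prod_j th j ^+ ymon k j = a0 k * u0 + a1 k * u1) ->
  qeval th (lin x) = x.1 * u0 + x.2 * u1.
Proof.
move=> thE; have th_g := g_points thE.
have [] : qeval th z0 = u0 /\ qeval th z1 = u1.
  apply: pencil_unique => k; rewrite -thE -mevalX -(qeval_class th_g) class_y.
  by rewrite qevalD // !qevalM // !qeval_cst.
by rewrite /lin qevalD // !qevalM // !qeval_cst // => -> ->.
Qed.

(** The scaling by [mu] in [exists_point] does not affect the vanishing of linear forms, so only the
    direction of [(u0, u1)] matters. *)
Lemma separating_point u0 u1 (D : pred 'I_N) (qs : seq (quot_ring g)) :
  (forall k, (a0 k * u0 + a1 k * u1 == 0) =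
             [exists v, (blk v == Some k) && D v]) ->
  (forall q, q \in qs -> (exists2 v, ~~ D v & q = qclass g 'X_v) \/
     (exists2 x, x.1 * u0 + x.2 * u1 != 0 & q = lin x)) ->
  exists th, [/\ forall i, (g i).@[th] = 0,
    forall v, D v -> qeval th (qclass g 'X_v) = 0,
    forall x, x.1 * u0 + x.2 * u1 = 0 -> qeval th (lin x) = 0 &
    forall q, q \in qs -> qeval th q != 0].
Proof.
move=> uD qsP; have [mu [th [mu0 thD thE]]] := exists_point uD.
have th_g := g_points thE; exists th; split=> //.
- by move=> v Dv; rewrite qeval_class // mevalXU; apply/eqP; rewrite thD.
- by move=> x x0; rewrite (qeval_lin x thE) !(mulrCA _ mu) -mulrDr x0 mulr0.
- move=> q /qsP[[v Dv ->]|[x x0 ->]].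
    by rewrite qeval_class // mevalXU thD.
  by rewrite (qeval_lin x thE) !(mulrCA _ mu) -mulrDr mulf_neq0.
Qed.

Lemma linear_poly_neq0 (x : F * F) : (x.1 != 0) || (x.2 != 0) ->
  x.1 *: 'X + x.2%:P != 0 :> {poly F}.
Proof.
move=> x0; apply: contraTneq x0 => /polyP E.
have := E 1%N; rewrite coefD coefZ coefX coefC /= mulr1 addr0 coef0 => ->.
have := E 0%N; rewrite coefD coefZ coefX coefC /= mulr0 add0r coef0 => ->.
by rewrite eqxx.
Qed.

Lemma nonspecial_neq0 x : nonspecial x -> (x.1 != 0) || (x.2 != 0).
Proof.
move=> /(_ ord0); apply: contraNT; rewrite negb_or !negbK => /andP[/eqP-> /eqP->].
by rewrite !mul0r subrr.
Qed.

(** Normalizing the direction to [(t, 1)] leaves one unknown. Each condition excludes the roots of a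
    non-zero polynomial of degree at most 1, and over an algebraically closed field the product of
    these polynomials has a non-root. *)
Lemma generic_direction (V : pred 'I_N) (qs : seq (quot_ring g)) :
  (forall q, q \in qs -> (exists2 v, V v & q = qclass g 'X_v) \/
     (exists2 x, nonspecial x & q = lin x)) -> exists t : F,
  (forall k, a0 k * t + a1 k != 0) /\
  forall q, q \in qs -> (exists2 v, V v & q = qclass g 'X_v) \/
     (exists2 x, x.1 * t + x.2 != 0 & q = lin x).
Proof.
move=> qsP.
have [f f0 fP] : exists2 f : {poly F}, f != 0 & forall t, f.[t] != 0 ->
    forall q, q \in qs -> (exists2 v, V v & q = qclass g 'X_v) \/
     (exists2 x, x.1 * t + x.2 != 0 & q = lin x).
  elim: qs qsP => [|q qs IHqs] qsP; first by exists 1; rewrite ?oner_neq0.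
  have [q' q'qs|f f0 fP] := IHqs; first by apply: qsP; rewrite inE q'qs orbT.
  have [qV|[x xP Eq]] := qsP q (mem_head q qs).
    exists f => // t ft q'; rewrite inE => /orP[/eqP->|]; first by left.
    exact: fP.
  exists (f * (x.1 *: 'X + x.2%:P)).
    by rewrite mulf_neq0 // linear_poly_neq0 // nonspecial_neq0.
  move=> t; rewrite hornerM mulf_eq0 negb_or => /andP[ft xt] q'.
  rewrite inE => /orP[/eqP->|]; last exact: fP.
  by right; exists x; move: xt; rewrite // hornerD hornerZ hornerX hornerC.
have h0 : f * \prod_k (a0 k *: 'X + (a1 k)%:P) != 0.
  rewrite mulf_neq0 //; apply/prodf_neq0 => k _.
  apply: (linear_poly_neq0 (x := (a0 k, a1 k))).
  have [j /a_indep] := exists_other k; apply: contraNT.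
  by rewrite negb_or !negbK => /= /andP[/eqP-> /eqP->]; rewrite mul0r mulr0 subrr.
have [t] := elimT (closed_nonrootP _) h0.
rewrite rootM negb_or => /andP[ft ht]; exists t; split; last exact: fP.
move=> k; apply: contraNneq ht => ak; rewrite /root horner_prod.
by rewrite (bigD1 k) //= hornerD hornerZ hornerX hornerC ak mul0r.
Qed.

Lemma atoms_nonvanishing (qs : seq (quot_ring g)) :
  (forall q, q \in qs -> atom q) ->
  exists th, (forall i, (g i).@[th] = 0) /\
    forall q, q \in qs -> qeval th q != 0.
Proof.
move=> qsA; have [q qq|t [at0 qsP]] := @generic_direction predT qs.
  by have [[v ->]|] := qsA q qq; [left; exists v|right].
have [|q qq|th [th_g _ _ qs0]] := @separating_point t 1 pred0 qs.
- move=> k; rewrite mulr1 (negPf (at0 k)); apply/esym/existsP => -[v].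
  by rewrite andbF.
- by have [[v _ ->]|[x x0 ->]] := qsP q qq;
    [left; exists v|right; exists x; rewrite ?mulr1].
- by exists th.
Qed.

Lemma var_separated v (qs : seq (quot_ring g)) :
  (forall q, q \in qs -> (exists2 w, w != v & q = qclass g 'X_w) \/
    (exists2 x, nonspecial x & q = lin x)) ->
  exists th, [/\ forall i, (g i).@[th] = 0, qeval th (qclass g 'X_v) = 0 &
    forall q, q \in qs -> qeval th q != 0].
Proof.
move=> qsP.
have [u [uD uqs]] : exists u : F * F,
    (forall k, (a0 k * u.1 + a1 k * u.2 == 0) =
           [exists w, (blk w == Some k) && pred1 v w]) /\
    (forall q, q \in qs -> (exists2 w, w != v & q = qclass g 'X_w) \/
        (exists2 x, x.1 * u.1 + x.2 * u.2 != 0 & q = lin x)).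
  case bv: (blk v) => [k|].
    (* This is the zero of the form of block [k]. No other block form vanishes there, so [v] can be
       the only variable with value 0. *)
    exists (- a1 k, a0 k); split=> [j|q qq] /=.
      have [->|jk] := eqVneq j k.
        rewrite mulrN addrC [_ * a0 _]mulrC subrr eqxx.
        by apply/esym/existsP; exists v; rewrite bv !eqxx.
      rewrite mulrN addrC [a1 j * _]mulrC (negPf (a_indep _)) 1?eq_sym //.
      apply/esym/existsP => -[w /andP[/eqP bw /eqP wv]].
      by move: bw; rewrite wv bv => -[kj]; rewrite kj eqxx in jk.
    have [|[x xP Eq]] := qsP q qq; first by left.
    by right; exists x; rewrite // mulrN addrC -opprB oppr_eq0.
  (* A variable outside all blocks can be put to 0 over any generic direction. *)
  have [t [at0 tqs]] := generic_direction qsP.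
  exists (t, 1); split=> [k|q /tqs[|[x x0 Eq]]] /=; [|by left|].
    rewrite mulr1 (negPf (at0 k)); apply/esym/existsP => -[w /andP[bw]].
    by move=> /eqP wv; rewrite wv bv in bw.
  by right; exists x; rewrite // mulr1.
have [//|q qq|th [th_g varP0 _ qs0]] := @separating_point u.1 u.2 (pred1 v) qs.
  by have [|] := uqs q qq; [left|right].
by exists th; split=> //; apply: varP0 => /=.
Qed.

(** For a linear form the point lies over its zero [(- x.2, x.1)]. Being nonspecial, the form shares
    this zero with no block form, so no variable has to vanish; another linear form vanishes there
    only if it is proportional. *)
Lemma atom_separated p (qs : seq (quot_ring g)) :
  atom p -> (forall q, q \in qs -> atom q) ->
  (forall q c, q \in qs -> c != 0 -> q <> qcst g c * p) ->
  exists th, [/\ forall i, (g i).@[th] = 0, qeval th p = 0 &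
    forall q, q \in qs -> qeval th q != 0].
Proof.
move=> pP qsP sep.
case: pP => [[v Ep]|[x xP Ep]].
- rewrite Ep; apply: var_separated => q qq.
  have [[w Eq]|] := qsP q qq; [left|by right].
  exists w => //; apply/eqP => wv; apply: (sep q 1 qq); first exact: oner_neq0.
  by rewrite rmorph1 mul1r Ep Eq wv.
- have [|q qq|th [th_g _ linP qs0]] := @separating_point (- x.2) x.1 pred0 qs.
  + move=> k; rewrite mulrN addrC [_ * x.1]mulrC [_ * x.2]mulrC (negPf (xP k)).
    by apply/esym/existsP => -[v]; rewrite andbF.
  + have [[w Eq]|[x' x'P Eq]] := qsP q qq; first by left; exists w.
    right; exists x' => //; apply/eqP => xx'.
    have xx : x'.1 * x.2 = x'.2 * x.1.
      by apply/eqP; rewrite eq_sym -subr_eq0 -xx' mulrN addrC.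
    have [c c0 [E1 E2]] : exists2 c, c != 0 & x'.1 = c * x.1 /\ x'.2 = c * x.2.
      have := nonspecial_neq0 x'P; have := nonspecial_neq0 xP.
      have [x10|x10 _] := eqVneq x.1 0 => /=.
        move=> x20; move/eqP: xx; rewrite x10 mulr0 mulf_eq0 (negPf x20) orbF.
        move=> /eqP->; rewrite eqxx /= => x'20; exists (x'.2 / x.2).
          by rewrite mulf_neq0 ?invr_eq0.
        by rewrite mulr0 divfK.
      have E2 : x'.2 = x'.1 / x.1 * x.2 by rewrite mulrAC xx mulfK.
      have [x'10|x'10 _] := eqVneq x'.1 0.
        by rewrite E2 x'10 !mul0r eqxx.
      by exists (x'.1 / x.1); rewrite ?mulf_neq0 ?invr_eq0 // divfK.
    by apply: (sep q c qq c0); rewrite Eq Ep /lin E1 E2 !rmorphM mulrDr !mulrA.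
  + exists th; split=> //; rewrite Ep; apply: linP.
    by rewrite mulrN mulrC addNr.
Qed.

(** The lattice spanned by the rows of [P0], described symmetrically in all blocks including [ord0];
    [block_lattice_rows] gives the translation. *)
Definition block_lattice (v : 'cV[int]_N) : Prop :=
  exists2 c : 'I_r.+1 -> int, \sum_i c i = 0 &
    forall j, v j 0 = if blk j is Some i then c i * (lv j)%:Z else 0.

Lemma block_lattice0 : block_lattice 0.
Proof.
exists (fun=> 0) => [|j]; first by rewrite big1.
by rewrite mxE; case: (blk j) => // i; rewrite mul0r.
Qed.

Lemma block_latticeB x y :
  block_lattice x -> block_lattice y -> block_lattice (x - y).
Proof.
move=> [c c0 xE] [d d0 yE]; exists (fun i => c i - d i).
  by rewrite sumrB c0 d0 subrr.
move=> j; rewrite !mxE xE yE; case: (blk j) => [i|]; last by rewrite subrr.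
by rewrite mulrBl.
Qed.

Hypothesis g_homog : forall i, exists v, mhomog block_lattice v (g i).

Let G := qcomp_grading block_lattice0 block_latticeB g_homog.
Local Notation comp := (qcomp block_lattice g).

Lemma ymon_homog k :
  mhomog block_lattice (mdegree (ymon ord0)) ('X_[ymon k] : {mpoly F[N]}).
Proof.
apply: mhomogX; exists (fun i => (i == k)%:Z - (i == ord0)%:Z).
  rewrite sumrB (bigD1 k) //= [X in _ - X](bigD1 ord0) //= !eqxx.
  by rewrite !big1 ?addr0 ?subrr // => i /negPf->.
move=> j; rewrite !mxE !mnmE; case: (blk j) => [i|] //.
have someE a : (Some i == Some a) = (i == a) by [].
by rewrite !someE; do 2!case: (i == _);
  rewrite ?subr0 ?subrr ?mul1r ?mul0r ?sub0r ?mulN1r.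
Qed.

(** Homogeneity of [z0] and [z1] is not part of the setting: Cramer's rule for two blocks writes
    them as combinations of block monomials, which all have the same degree. *)
Lemma lin_comp x : comp (mdegree (ymon ord0)) (lin x).
Proof.
have comp_cst w c y : comp w y -> comp w (qcst g c * y).
  move=> yw; rewrite -[w]add0r; apply: (gradingM G) => //.
  exact: grading_cst G _.
have yP k c : comp (mdegree (ymon ord0)) (qcst g c * qclass g 'X_[ymon k]).
  by apply: comp_cst; exists 'X_[ymon k]; first exact: ymon_homog.
have [j /a_indep D0] := exists_other ord0.
set D := (X in X != 0) in D0.
have unscale y : comp (mdegree (ymon ord0)) (qcst g D * y) ->
    comp (mdegree (ymon ord0)) y.
  by move/(comp_cst _ D^-1); rewrite mulrA -rmorphM mulVf // rmorph1 mul1r.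
apply: (gradingD G); apply: comp_cst; apply: unscale.
  have -> : qcst g D * z0 = qcst g (a1 j) * qclass g 'X_[ymon ord0]
      - qcst g (a1 ord0) * qclass g 'X_[ymon j].
    by rewrite !class_y /D rmorphB !rmorphM; ring.
  exact: (gradingB G).
have -> : qcst g D * z1 = qcst g (a0 ord0) * qclass g 'X_[ymon j]
    - qcst g (a0 j) * qclass g 'X_[ymon ord0].
  by rewrite !class_y /D rmorphB !rmorphM; ring.
exact: (gradingB G).
Qed.

Lemma atom_homogeneous q : atom q -> homogeneous comp q.
Proof.
move=> [[v ->]|[x _ ->]]; last by exists (mdegree (ymon ord0)); apply: lin_comp.
exists (mdegree U_(v)), 'X_v => //; apply: mhomogX; rewrite subrr.
exact: block_lattice0.
Qed.

Definition atomic (x : quot_ring g) : Prop :=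
  exists c s, (forall q, q \in s -> atom q) /\ x = qcst g c * \prod_(q <- s) q.

Lemma mul_const_prod c d (s t : seq (quot_ring g)) :
  qcst g c * \prod_(q <- s) q * (qcst g d * \prod_(q <- t) q) =
  qcst g (c * d) * \prod_(q <- s ++ t) q.
Proof. by rewrite big_cat rmorphM mulrACA. Qed.

Lemma atomicM x y : atomic x -> atomic y -> atomic (x * y).
Proof.
move=> [c [s [sP ->]]] [d [t [tP ->]]]; exists (c * d), (s ++ t); split.
  by move=> q; rewrite mem_cat => /orP[/sP|/tP].
exact: mul_const_prod.
Qed.

Lemma atomic_cst c : atomic (qcst g c).
Proof. by exists c, [::]; rewrite big_nil mulr1. Qed.

Lemma atomic_atom q : atom q -> atomic q.
Proof.
move=> qP; exists 1, [:: q]; split; first by move=> p; rewrite inE => /eqP->.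
by rewrite big_seq1 rmorph1 mul1r.
Qed.

Lemma atomic_monomial u : atomic (qclass g 'X_[u]).
Proof.
rewrite mpolyXE_id rmorph_prod; elim/big_ind: _ => [||v _].
- by rewrite -(rmorph1 (qcst g)); apply: atomic_cst.
- exact: atomicM.
- rewrite rmorphXn /=; elim: (u v) => [|n IHn].
    by rewrite expr0 -(rmorph1 (qcst g)); apply: atomic_cst.
  by rewrite exprS; apply: atomicM => //; apply: atomic_atom; left; exists v.
Qed.

(** A special form is proportional to some [(a0 k, a1 k)], hence a constant times a block monomial,
    which is a product of variables. *)
Lemma atomic_lin x : atomic (lin x).
Proof.
have [xP|/existsNP[k /negP]] := EM (nonspecial x).
  by apply: atomic_atom; right; exists x.
rewrite negbK subr_eq0 => /eqP xk.
have [c [E1 E2]] : exists c, x.1 = c * a0 k /\ x.2 = c * a1 k.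
  have [a00|a00] := eqVneq (a0 k) 0; last first.
    exists (x.1 / a0 k); rewrite divfK //; split=> //.
    by rewrite mulrAC xk mulfK.
  have a10 : a1 k != 0.
    have [j /a_indep] := exists_other k; apply: contraNneq => ->.
    by rewrite a00 mul0r mulr0 subrr.
  exists (x.2 / a1 k); rewrite divfK // a00 mulr0; split=> //.
  by apply: (mulIf a10); rewrite xk a00 mul0r mulr0.
have -> : lin x = qcst g c * qclass g 'X_[ymon k].
  by rewrite class_y /lin E1 E2 !rmorphM mulrDr !mulrA.
by apply: atomicM; [apply: atomic_cst|apply: atomic_monomial].
Qed.

(** The homogenization of [h] to degree [n], evaluated at [z0] and [z1]. If the degree of [h] is
    below [n], the difference stands for factors [z1]. *)
Definition form_eval (n : nat) (h : {poly F}) : quot_ring g :=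
  \sum_(i < n.+1) qcst g h`_i * z0 ^+ i * z1 ^+ (n - i).

Lemma form_eval_lin n (h : {poly F}) (x : F * F) : (size h <= n.+1)%N ->
  form_eval n.+1 ((x.1 *: 'X + x.2%:P) * h) = lin x * form_eval n h.
Proof.
move=> hn; rewrite /form_eval /lin mulrDl -scalerAl [RHS]mulrDl.
under eq_bigr => i _.
  rewrite coefD coefZ coefXM coefCM rmorphD /= !mulrDl.
over.
rewrite big_split /=; congr (_ + _).
  rewrite big_ord_recl /= mulr0 rmorph0 !mul0r add0r mulr_sumr.
  apply: eq_bigr => i _; rewrite /= subSS rmorphM exprS; ring.
rewrite big_ord_recr /= nth_default // mulr0 rmorph0 !mul0r addr0 mulr_sumr.
apply: eq_bigr => i _; rewrite subSn -1?ltnS // rmorphM exprS; ring.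
Qed.

Lemma atomic_form n (h : {poly F}) : (size h <= n.+1)%N -> atomic (form_eval n h).
Proof.
elim: n h => [|n IHn] h hn.
  by rewrite /form_eval big_ord1 !mulr1; apply: atomic_cst.
(* If [h] does not reach the top degree, the linear form [z1] splits off; otherwise [h] has a root
   [t], and [z0 - t z1] splits off. *)
have [hn'|hn'] := leqP (size h) n.+1.
  have -> : h = ((0 : F) *: 'X + 1%:P) * h by rewrite scale0r add0r mul1r.
  rewrite (form_eval_lin (0, 1)) //; apply: atomicM; first exact: atomic_lin.
  exact: IHn.
have /closed_rootP[t /factor_theorem[h' Eh]] : size h != 1%N.
  by rewrite neq_ltn (leq_trans _ hn') ?orbT.
have h'0 : h' != 0.
  by apply: contraTneq hn' => h'0; rewrite Eh h'0 mul0r size_poly0.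
have hn1 : (size h' <= n.+1)%N.
  by move: hn; rewrite Eh size_mul ?polyXsubC_eq0 // size_XsubC addn2 /= ltnS.
have -> : h = (1 *: 'X + (- t)%:P) * h' by rewrite Eh scale1r polyCN mulrC.
rewrite (form_eval_lin (1, - t)) //; apply: atomicM; first exact: atomic_lin.
exact: IHn.
Qed.

Definition is_form (n : nat) (x : quot_ring g) : Prop :=
  exists2 h : {poly F}, (size h <= n.+1)%N & x = form_eval n h.

Lemma is_formD n x y : is_form n x -> is_form n y -> is_form n (x + y).
Proof.
move=> [h hn ->] [h' hn' ->]; exists (h + h').
  by apply: leq_trans (size_polyD _ _) _; rewrite geq_max hn.
rewrite /form_eval -big_split; apply: eq_bigr => i _.
have E : qcst g (h + h')`_i = qcst g h`_i + qcst g h'`_i.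
  by rewrite coefD rmorphD.
by rewrite E !mulrDl.
Qed.

Lemma is_form0 n : is_form n 0.
Proof.
exists 0; rewrite ?size_poly0 // /form_eval big1 // => i _.
by rewrite coef0 rmorph0 !mul0r.
Qed.

Lemma is_formZ n c x : is_form n x -> is_form n (qcst g c * x).
Proof.
move=> [h hn ->]; exists (c *: h); first by apply: leq_trans (size_scale_leq _ _) _.
rewrite /form_eval mulr_sumr; apply: eq_bigr => i _.
by rewrite coefZ rmorphM !mulrA.
Qed.

Lemma is_form1 : is_form 0 1.
Proof.
exists 1; first by rewrite size_poly1.
by rewrite /form_eval big_ord1 coefC /= rmorph1 !mulr1.
Qed.

Lemma is_form_lin n (x : F * F) y : is_form n y -> is_form n.+1 (lin x * y).
Proof.
move=> [h hn ->]; exists ((x.1 *: 'X + x.2%:P) * h); last by rewrite form_eval_lin.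
apply: leq_trans (size_polyMleq _ _) _.
have h2 : (size (x.1 *: 'X + x.2%:P)%R <= 2)%N.
  apply: leq_trans (size_polyD _ _) _; rewrite geq_max.
  rewrite (leq_trans (size_scale_leq _ _)) ?size_polyX //=.
  exact: leq_trans (size_polyC_leq1 _) _.
by rewrite -subn1 leq_subLR (leq_trans (leq_add h2 hn)).
Qed.

Lemma is_form_block_prod (e : 'I_r.+1 -> nat) :
  is_form (\sum_i e i) (\prod_i qclass g 'X_[ymon i] ^+ e i).
Proof.
elim/big_rec2: _ => [|i x n _ xn]; first exact: is_form1.
elim: (e i) => [|k IHk]; first by rewrite expr0 mul1r.
have -> : qclass g 'X_[ymon i] ^+ k.+1 * x =
    lin (a0 i, a1 i) * (qclass g 'X_[ymon i] ^+ k * x).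
  by rewrite exprS -mulrA /lin -class_y.
exact: is_form_lin.
Qed.

Lemma atomic_homogeneous x : homogeneous comp x -> atomic x.
Proof.
move=> [w [p hp ->]]; have [->|p0] := eqVneq p 0.
  by rewrite -(rmorph0 (@mpolyC N F)); apply: atomic_cst.
(* [c u i] measures in multiples of [l_i] how far the monomial [u] exceeds the reference vector [w]
   in block [i]. *)
have /choice[c cP] (u : 'X_{1..N}) : exists c : 'I_r.+1 -> int, u \in msupp p ->
    \sum_i c i = 0 /\ forall j, (u j)%:Z - w j 0 =
      if blk j is Some i then c i * (lv j)%:Z else 0.
  have [up|up] := boolP (u \in msupp p); last by exists (fun=> 0).
  have [c c0 cE] := hp u up; exists c => _; split=> // j.
  by rewrite -cE !mxE.
have pn0 : msupp p != [::] by rewrite msupp_eq0.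
have /choice[low lowP] (i : 'I_r.+1) : exists u, u \in msupp p /\
    {in msupp p, forall v, c u i <= c v i}.
  by have [u up umin] := seq_min (c^~ i) pn0; exists u.
(* X^nu is the largest monomial dividing p up to block monomials. *)
pose nu := [multinom (low (odflt ord0 (blk j))) j | j < N].
pose e u i := absz (c u i - c (low i) i)%R.
have eE u i : u \in msupp p -> (e u i)%:Z = c u i - c (low i) i.
  by move=> up; rewrite gez0_abs // subr_ge0; apply: (lowP i).2.
(* Outside the blocks all monomials of [p] agree with [w], so the default block [ord0] in [nu] is
   harmless. *)
have uE u : u \in msupp p -> u = (nu + \sum_i (ymon i *+ e u i))%MM.
  move=> up; apply/mnmP => j; rewrite mnmDE mnm_sumE mnmE.
  under eq_bigr => i _ do rewrite mulmnE mnmE.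
  have [lp _] := lowP (odflt ord0 (blk j)).
  have := (cP _ up).2 j; have := (cP _ lp).2 j.
  case E: (blk j) => [i|] /= El Eu; apply/eqP; rewrite -eqz_nat PoszD.
    rewrite (bigD1 i) //= eqxx big1 ?addn0 => [|i' i'i]; last first.
      by rewrite eq_sym (inj_eq Some_inj) (negPf i'i).
    rewrite PoszM eE //; move/eqP: El; rewrite subr_eq => /eqP->.
    move/eqP: Eu; rewrite subr_eq => /eqP->; apply/eqP; ring.
  rewrite big1 // addr0; apply/eqP.
  by move/eqP: El; rewrite subr_eq0 => /eqP->; apply/eqP; rewrite -subr_eq0 Eu.
(* Since the [c u i] sum to 0, the total exponent in the block monomials does not depend on [u]: the
   cofactor of the monomial [nu] is a binary form. *)
have sum_e u : u \in msupp p -> (\sum_i e u i)%N = absz (- \sum_i c (low i) i)%R.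
  move=> up; have -> : - \sum_i c (low i) i = \sum_i (e u i)%:Z.
    under [RHS]eq_bigr do rewrite eE //.
    by rewrite sumrB (cP _ up).1 sub0r.
  by rewrite -(big_morph _ PoszD (erefl 0%:Z)).
set q := absz _ in sum_e.
have -> : qclass g p = qclass g 'X_[nu] *
    \sum_(u <- msupp p) qcst g p@_u * \prod_i qclass g 'X_[ymon i] ^+ e u i.
  rewrite {1}[p]mpolyE rmorph_sum mulr_sumr /= !big_seq; apply: eq_bigr => u up.
  rewrite {2}(uE u up) mpolyXD -mprodXE -mul_mpolyC !rmorphM /= rmorph_prod.
  rewrite mulrCA; congr (_ * (_ * _)); apply: eq_bigr => i _.
  by rewrite -mpolyXn rmorphXn.
apply: atomicM; first exact: atomic_monomial.
suff [h hq ->] : is_form q (\sum_(u <- msupp p)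
    qcst g p@_u * \prod_i qclass g 'X_[ymon i] ^+ e u i) by apply: atomic_form.
rewrite big_seq; elim/big_ind: _ => [||u up]; first exact: is_form0.
  by move=> *; apply: is_formD.
by apply: is_formZ; rewrite -(sum_e u up); apply: is_form_block_prod.
Qed.

Lemma quot_neq0 : (1 : quot_ring g) <> 0.
Proof.
move=> E; have [//|th [th_g _]] := @atoms_nonvanishing [::].
have /eqP : qeval th (1 : quot_ring g) = 0 by rewrite E qeval0.
by rewrite qeval1 // oner_eq0.
Qed.

Lemma prod_atoms_neq0 c (s : seq (quot_ring g)) : c != 0 ->
  (forall q, q \in s -> atom q) -> qcst g c * \prod_(q <- s) q <> 0.
Proof.
move=> c0 sP E; have [th [th_g qs0]] := atoms_nonvanishing sP.
have : qeval th (qcst g c * \prod_(q <- s) q) == 0 by rewrite E qeval0.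
rewrite qevalM // qeval_cst // qeval_prod // mulf_eq0 (negPf c0) /=.
by rewrite prodf_seq_eq0 => /hasP[q /qs0/negPf /= ->].
Qed.

Lemma homogeneous_atoms x : homogeneous comp x -> x <> 0 -> exists c s,
  [/\ c != 0, forall q, q \in s -> atom q & x = qcst g c * \prod_(q <- s) q].
Proof.
move=> /atomic_homogeneous[c [s [sP E]]] x0; exists c, s; split=> //.
by apply/eqP => c0; apply: x0; rewrite E c0 rmorph0 mul0r.
Qed.

Lemma atom_prime p : atom p -> graded_prime comp p.
Proof.
move=> pP; split; first exact: atom_homogeneous.
- move=> p0; apply: (@prod_atoms_neq0 1 [:: p]); first exact: oner_neq0.
    by move=> q; rewrite inE => /eqP->.
  by rewrite big_seq1 p0 mulr0.
- move=> [y py]; have [//|//|th [th_g p0 _]] := @atom_separated p [::] pP.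
  have /eqP : qeval th (p * y) = 0 by rewrite qevalM // p0 mul0r.
  by rewrite py qeval1 // oner_eq0.
move=> x y hx hy [t Et].
have [->|x0] := EM (x = 0); first by left; exists 0; rewrite mulr0.
have [->|y0] := EM (y = 0); first by right; exists 0; rewrite mulr0.
have [c [s [c0 sP Ex]]] := homogeneous_atoms hx x0.
have [d [s' [d0 s'P Ey]]] := homogeneous_atoms hy y0.
have dvd b (s0 : seq (quot_ring g)) a q : q \in s0 -> q = qcst g a * p ->
    divides p (qcst g b * \prod_(q <- s0) q).
  move=> qs E; apply: dividesMr; apply: divides_trans (divides_prod_mem qs).
  by rewrite E; apply: dividesMr; exists 1; rewrite mulr1.
have [[q [a [qs an0 Eq]]]|nos] :=
    EM (exists q a, [/\ q \in s, a != 0 & q = qcst g a * p]).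
  by left; rewrite Ex; apply: dvd qs Eq.
have [[q [a [qs an0 Eq]]]|nos'] :=
    EM (exists q a, [/\ q \in s', a != 0 & q = qcst g a * p]).
  by right; rewrite Ey; apply: dvd qs Eq.
have [q|q a|th [th_g p0 qs0]] := @atom_separated p (s ++ s') pP.
- by rewrite mem_cat => /orP[/sP|/s'P].
- rewrite mem_cat => /orP[] qs an0 Eq; [case: nos|case: nos'];
  by exists q, a.
have /eqP : qeval th (x * y) = 0 by rewrite Et qevalM // p0 mul0r.
rewrite Ex Ey mul_const_prod qevalM // qeval_cst // qeval_prod //.
rewrite !mulf_eq0 (negPf c0) (negPf d0) /= prodf_seq_eq0.
by move=> /hasP[q /qs0/negPf /= ->].
Qed.

Lemma block_const_factorial : const_factorial (qcst g) comp.
Proof.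
split=> [x y hx hy x0 y0|x hx x0].
  have [c [s [c0 sP ->]]] := homogeneous_atoms hx x0.
  have [d [s' [d0 s'P ->]]] := homogeneous_atoms hy y0.
  rewrite mul_const_prod; apply: prod_atoms_neq0.
    by rewrite mulf_neq0.
  by move=> q; rewrite mem_cat => /orP[/sP|/s'P].
have [c [s [c0 sP E]]] := homogeneous_atoms hx x0.
by exists c, s; split=> // q /sP/atom_prime.
Qed.

Lemma var_prime v : graded_prime comp (qclass g 'X_v).
Proof. by apply: atom_prime; left; exists v. Qed.

Lemma var_nonassociated v w : v != w ->
  ~ associated (qclass g 'X_v) (qclass g 'X_w).
Proof.
move=> vw [u [u' Eu] Ew].
have [q|th [th_g v0 qs0]] := @var_separated v [:: qclass g 'X_w].
  by rewrite inE => /eqP->; left; exists w; rewrite // eq_sym.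
have /eqP := qs0 _ (mem_head _ _); case.
by rewrite Ew qevalM // v0 mulr0.
Qed.

End PencilQuotient.

(** * Adding the rows of d *)

Lemma gcd_combination (n : nat) (f : 'I_n -> int) :
  exists t : 'I_n -> int,
    \sum_i t i * f i = (\big[gcdn/0]_(i < n) `|f i|)%N%:Z.
Proof.
elim/big_ind: _ => [|x y [t tx] [t' ty]|i _].
- by exists (fun=> 0); rewrite big1 // => i _; rewrite mul0r.
- have [u [v uv]] := Bezoutz x y; exists (fun i => u * t i + v * t' i).
  rewrite -[RHS]uv -tx -ty !mulr_sumr -big_split; apply: eq_bigr => i _ /=.
  by rewrite mulrDl !mulrA.
- exists (fun j => (j == i)%:R * Num.sg (f i)).
  rewrite (bigD1 i) //= eqxx mul1r big1 ?addr0 => [|j /negPf->]; last first.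
    by rewrite !mul0r.
  by rewrite abszE normrEsg.
Qed.

Section DegreeProjection.
Variables (M N : nat) (P : 'M[int]_(M, N)).

Lemma degree_projP x y :
  degree_proj P x = degree_proj P y <-> exists u : 'cV[int]_M, x - y = P^T *m u.
Proof.
have H : reflect (degree_proj P x = degree_proj P y) (x - y \in im_dual P).
  by rewrite Quotient.idealrBE; apply: (iffP eqP).
by split=> [/H/asboolP|/asboolP Exy]; last exact/H.
Qed.

Lemma degree_proj_is_additive : zmod_morphism (degree_proj P).
Proof. by move=> x y; rewrite /degree_proj raddfB. Qed.

HB.instance Definition _ :=
  GRing.isZmodMorphism.Build _ _ (degree_proj P) degree_proj_is_additive.

Lemma degree_proj_repr (w : degree_group P) : degree_proj P (repr w) = w.
Proof. exact: reprK. Qed.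

Lemma mnm_degreeE (u : 'X_{1..N}) : mnm_degree P u = degree_proj P (mdegree u).
Proof.
have -> : mdegree u = \sum_i delta_mx i 0 *+ u i.
  rewrite [LHS]matrix_sum_delta; apply: eq_bigr => i _.
  by rewrite big_ord1 mxE -scaler_nat natz.
by rewrite raddf_sum; apply: eq_bigr => i _; rewrite raddfMn.
Qed.

(** As column [i] is primitive, some integral combination of the rows has entry 1 at [i].
    Subtracting a multiple of it clears coordinate [i] of a representative without changing the
    degree. *)
Lemma primitive_almost_free :
  (forall j, primitive_vector (col j P)) -> almost_free (vdeg P).
Proof.
move=> P_prim i w; have [t t1] := gcd_combination (fun a => col i P a 0).
have tP : \sum_a P a i * t a = 1.
  rewrite (P_prim i) in t1; apply: etrans _ t1.
  by apply: eq_bigr => a _; rewrite mxE mulrC.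
pose x := repr w; pose x' := x - P^T *m (x i 0 *: (\col_a t a)).
have x'i : x' i 0 = 0.
  rewrite mxE [X in _ + X]mxE -scalemxAr [X in _ - X]mxE [X in _ * X]mxE.
  under eq_bigr => a _ do rewrite !mxE.
  by rewrite tP mulr1 subrr.
exists (fun j => x' j 0).
have -> : w = degree_proj P x'.
  rewrite -[w]degree_proj_repr; apply/degree_projP.
  by exists (x i 0 *: \col_a t a); rewrite opprB addrC subrK.
rewrite [x' in LHS]matrix_sum_delta raddf_sum (bigD1 i) //= big_ord1.
rewrite x'i scale0r raddf0 add0r; apply: eq_bigr => j _.
by rewrite big_ord1 -[x' j 0 in LHS]intz scaler_int raddfMz.
Qed.

Lemma row_full_injective : row_full (map_mx (intr : int -> rat) P)^T ->
  forall u : 'cV[int]_M, P^T *m u = 0 -> u = 0.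
Proof.
move=> /row_fullP[B BP] u Pu.
have : map_mx (intr : int -> rat) u = 0.
  rewrite -[LHS]mul1mx -BP -mulmxA map_trmx -map_mxM Pu.
  by rewrite map_mx0 mulmx0.
move=> /matrixP E; apply/matrixP => i j; have := E i j; rewrite !mxE.
by move/eqP; rewrite intr_eq0 => /eqP.
Qed.

End DegreeProjection.

(** Primality depends on a grading only through its homogeneous elements; this transfers it from
    vectors modulo a lattice to [degree_group]. *)
Lemma eq_graded_prime (V W : zmodType) (R : comPzRingType)
    (C : V -> R -> Prop) (D : W -> R -> Prop) :
  (forall x, homogeneous C x <-> homogeneous D x) ->
  forall p, graded_prime C p -> graded_prime D p.
Proof.
move=> CD p [hp p0 pU pP]; split=> //; first exact/CD.
by move=> x y hx hy; apply: pP; apply/CD.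
Qed.

Lemma mulmxMz (a b c : nat) (A : 'M[int]_(a, b)) (B : 'M[int]_(b, c)) (i : int) :
  A *m (B *~ i) = (A *m B) *~ i.
Proof. exact: (raddfMz (mulmx A)). Qed.

Definition factorially_graded (W : zmodType) (R : comPzRingType)
    (comp : W -> R -> Prop) (F : nzRingType) (const : F -> R) (N : nat)
    (deg : 'I_N -> W) (var : 'I_N -> R) : Prop :=
  [/\ almost_free deg, factorial_grading comp &
      forall x, homogeneous comp x -> is_unit x ->
        exists2 c : F, c != 0 & x = const c] /\
  [/\ forall i, graded_prime comp (var i),
      forall i j, i != j -> var i <> var j,
      forall i j, i != j -> ~ associated (var i) (var j) &
      algebra_generators const var].

Section RowChain.
Variables (F : fieldType) (N r s : nat) (Q : 'M[int]_(r, N)) (d : 'M[int]_(s, N)).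
Variables (ng : nat) (g : 'I_ng -> {mpoly F[N]}).

(** The span of the rows of [Q] and the first [k] rows of [d]. Zero coordinates replace a submatrix,
    so that [w] has the same size for all [k]. *)
Definition row_lattice (k : nat) (x : 'cV[int]_N) : Prop :=
  exists u : 'cV[int]_r, exists2 w : 'cV[int]_s,
    forall i : 'I_s, (k <= i)%N -> w i 0 = 0 & x = Q^T *m u + d^T *m w.

Lemma row_lattice_init : row_lattice 0 = fun x => exists u, x = Q^T *m u.
Proof.
apply/funext => x; apply/propext; split=> [[u [w w0 ->]]|[u ->]].
  exists u; suff -> : w = 0 by rewrite mulmx0 addr0.
  by apply/matrixP => i j; rewrite ord1 w0 ?mxE.
by exists u, 0 => [i|]; rewrite ?mxE // mulmx0 addr0.
Qed.

Lemma row_lattice_full x :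
  row_lattice s x <-> exists u, x = (col_mx Q d)^T *m u.
Proof.
rewrite tr_col_mx; split=> [[u [w _ ->]]|[u ->]].
  by exists (col_mx u w); rewrite mul_row_col.
exists (usubmx u), (dsubmx u); last by rewrite -mul_row_col vsubmxK.
by move=> i; rewrite leqNgt ltn_ord.
Qed.

Lemma row_lattice0 k : row_lattice k 0.
Proof. by exists 0, 0 => [i|]; rewrite ?mxE // !mulmx0 addr0. Qed.

Lemma row_latticeB k x y :
  row_lattice k x -> row_lattice k y -> row_lattice k (x - y).
Proof.
move=> [u [w w0 ->]] [u' [w' w'0 ->]]; exists (u - u'), (w - w').
  by move=> i ki; rewrite !mxE w0 ?w'0 ?subrr.
by rewrite !mulmxBr opprD addrACA.
Qed.

Lemma row_latticeS (k : 'I_s) x : row_lattice k.+1 x <->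
  exists i : int, row_lattice k (x - (d^T *m delta_mx k 0) *~ i).
Proof.
split=> [[u [w w0 ->]]|[i [u [w w0 E]]]].
  exists (w k 0), u, (w - delta_mx k 0 *~ w k 0).
    move=> i ki; rewrite mxE [X in _ + X]mxE -scaler_int !mxE eqxx andbT intz.
    have [->|ik] := eqVneq i k; first by rewrite mulr1 subrr.
    have ki' : (k < i)%N by rewrite ltn_neqAle eq_sym ik.
    by rewrite (w0 i ki') mulr0 subrr.
  by rewrite mulmxBr mulmxMz addrA.
exists u, (w + delta_mx k 0 *~ i).
  move=> j kj; have jk : (j == k) = false by apply: gtn_eqF.
  by rewrite mxE -scaler_int !mxE (w0 j (ltnW kj)) jk mulr0 addr0.
by rewrite mulmxDr mulmxMz addrA -E subrK.
Qed.

Hypothesis P_free : forall u : 'cV_(r + s), (col_mx Q d)^T *m u = 0 -> u = 0.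

(** Membership yields a linear relation between the rows of [P] in which row [k] of [d] has
    coefficient [- i]; the rows are independent. *)
Lemma row_lattice_free (k : 'I_s) (i : int) :
  row_lattice k ((d^T *m delta_mx k 0 : 'cV_N) *~ i) -> i = 0.
Proof.
move=> [u [w w0 E]]; have := P_free (u := col_mx u (w - delta_mx k 0 *~ i)).
rewrite tr_col_mx mul_row_col mulmxBr mulmxMz addrA -E subrr => /(_ erefl).
move=> /(congr1 dsubmx); rewrite col_mxKd => /matrixP/(_ k 0).
rewrite mxE -scaler_int !mxE w0 // !eqxx intz mulr1 add0r.
by move/eqP; rewrite oppr_eq0 => /eqP.
Qed.

Hypothesis g_homog : forall i, exists v, mhomog (row_lattice 0) v (g i).
Hypothesis R_nontriv : (1 : quot_ring g) <> 0.

Lemma row_lattice_homog k i : exists v, mhomog (row_lattice k) v (g i).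
Proof.
have [v hv] := g_homog i; exists v => u /hv[x [w w0 E]].
by exists x, w => // j _; apply: w0.
Qed.

Lemma row_chain k : (k <= s)%N ->
  const_factorial (qcst g) (qcomp (row_lattice 0) g) ->
  const_factorial (qcst g) (qcomp (row_lattice k) g) /\
  forall p, graded_prime (qcomp (row_lattice 0) g) p ->
    graded_prime (qcomp (row_lattice k) g) p.
Proof.
elim: k => [//|k IHk] ks fact.
have [fk pk] := IHk (ltnW ks) fact; pose k' := Ordinal ks.
split.
  exact: (refinement_factorial (row_lattice0 k) (@row_latticeB k)
    (row_lattice_homog k) (row_latticeS k') (@row_lattice_free k') R_nontriv fk).
move=> p /pk; exact: (refinement_prime (row_lattice0 k) (@row_latticeB k)
    (row_lattice_homog k) (row_latticeS k') (@row_lattice_free k')).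
Qed.

Let P := col_mx Q d.
Let comp (w : degree_group P) (x : quot_ring g) : Prop :=
  exists2 p, mpoly_component w p & x = qclass g p.

Lemma homogeneous_degree_group x :
  homogeneous (qcomp (row_lattice s) g) x <-> homogeneous comp x.
Proof.
split=> [[w [p hp ->]]|[w [p hp ->]]].
  exists (degree_proj P w), p => // u up; rewrite mnm_degreeE; apply/degree_projP.
  exact/row_lattice_full/hp.
exists (repr w), p => // u up; apply/row_lattice_full/degree_projP.
by rewrite degree_proj_repr -mnm_degreeE; apply: hp.
Qed.

Lemma quotient_graded_ring : admissible_matrix P ->
  const_factorial (qcst g) (qcomp (row_lattice 0) g) ->
  (forall i, graded_prime (qcomp (row_lattice 0) g) (qclass g 'X_i)) ->
  (forall i j, i != j -> ~ associated (qclass g 'X_i) (qclass g 'X_j)) ->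
  factorially_graded comp (fun c : F => qclass g c%:MP) (vdeg P)
    (fun i => qclass g 'X_i).
Proof.
move=> [_ P_prim _] /(row_chain (leqnn s))[fs ps] varP nonassoc.
have G := qcomp_grading (row_lattice0 s) (@row_latticeB s) (row_lattice_homog s).
have CD := eq_graded_prime homogeneous_degree_group.
split; split.
- exact: primitive_almost_free.
- have [dom fac] := const_factorial_factorial G fs; split=> [x y|x].
    by move=> /homogeneous_degree_group hx /homogeneous_degree_group; apply: dom.
  move=> /homogeneous_degree_group hx x0 xU; have [l [lP xl]] := fac x hx x0 xU.
  by exists l; split; [move=> p pl; apply: CD; apply: lP|].
- by move=> x /homogeneous_degree_group; apply: (homogeneous_unit_cst fs).
- by move=> i; apply: CD; apply: ps.
- move=> i j ij E; apply: (nonassoc i j ij); exists 1; last by rewrite mul1r.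
  by exists 1; rewrite mulr1.
- exact: nonassoc.
- move=> S Sc Sx SD SM y; rewrite -[y]qclass_repr [repr y]mpolyE rmorph_sum /=.
  elim/big_ind: _ => [|x x' Sx1 Sx2|u _]; last 1 first.
  + rewrite -mul_mpolyC rmorphM; apply: (SM _ _ (Sc _)).
    rewrite mpolyXE_id rmorph_prod; elim/big_ind: _ => [||v _].
    * by rewrite -(rmorph1 (qcst g)); apply: Sc.
    * exact: SM.
    * rewrite rmorphXn /=; elim: (u v) => [|n IHn].
        by rewrite expr0 -(rmorph1 (qcst g)); apply: Sc.
      by rewrite exprS; apply: (SM _ _ (Sx v) IHn).
  + by rewrite -(rmorph0 (qcst g)); apply: Sc.
  + exact: SD.
Qed.

End RowChain.

Lemma block_lattice_rows (N r : nat) (blk : 'I_N -> option 'I_r.+1)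
    (lv : 'I_N -> nat) (Q : 'M[int]_(r, N)) :
  (forall i v, Q i v =
     (ymon blk lv (lift ord0 i) v)%:Z - (ymon blk lv ord0 v)%:Z) ->
  block_lattice blk lv = fun x => exists u, x = Q^T *m u.
Proof.
move=> QE.
have sumE (c : 'I_r.+1 -> int) v : \sum_k c k * (ymon blk lv k v)%:Z =
    if blk v is Some k then c k * (lv v)%:Z else 0.
  case E: (blk v) => [k|]; last first.
    by rewrite big1 // => k _; rewrite mnmE E mulr0.
  rewrite (bigD1 k) //= mnmE E eqxx big1 ?addr0 // => k' k'k.
  by rewrite mnmE E (inj_eq Some_inj) eq_sym (negPf k'k) mulr0.
have QuE (u : 'cV_r) v : (Q^T *m u) v 0 =
    \sum_i u i 0 * (ymon blk lv (lift ord0 i) v)%:Z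
    - (\sum_i u i 0) * (ymon blk lv ord0 v)%:Z.
  rewrite mxE mulr_suml -sumrB; apply: eq_bigr => i _.
  by rewrite mxE QE mulrC mulrBr.
apply/funext => x; apply/propext; split=> [[c c0 xE]|[u ->]].
  exists (\col_i c (lift ord0 i)); apply/matrixP => v j.
  rewrite ord1 QuE xE -sumE.
  move: c0; rewrite !big_ord_recl /=.
  have -> : \sum_i (\col_i0 c (lift ord0 i0)) i 0 = \sum_i c (lift ord0 i).
    by apply: eq_bigr => i _; rewrite mxE.
  move/eqP; rewrite addr_eq0 => /eqP->; rewrite mulNr addrC; congr (_ - _).
  by apply: eq_bigr => i _; rewrite mxE.
(* Each row of [Q] is the difference of a block row and that of block [ord0], which therefore
   collects minus the sum of the coefficients. *)
exists (fun k => if unlift ord0 k is Some i then u i 0 else - \sum_i u i 0).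
  rewrite big_ord_recl unlift_none [X in _ + X](eq_bigr (fun i => u i 0)).
    by rewrite addNr.
  by move=> i _; rewrite liftK.
move=> v; rewrite -sumE QuE big_ord_recl unlift_none [LHS]addrC mulNr; congr (_ + _).
by apply: eq_bigr => i _; rewrite liftK.
Qed.

Lemma pencil_quotient_graded (F : closedFieldType) (N r s : nat) (r_gt0 : (0 < r)%N)
    (blk : 'I_N -> option 'I_r.+1) (lv : 'I_N -> nat) (a0 a1 : 'I_r.+1 -> F)
    (ng : nat) (g : 'I_ng -> {mpoly F[N]}) (z0 z1 : quot_ring g)
    (Q : 'M[int]_(r, N)) (d : 'M[int]_(s, N)) :
  let P := col_mx Q d in
  let comp (w : degree_group P) (x : quot_ring g) : Prop :=
    exists2 p, mpoly_component w p & x = qclass g p in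
  (forall v k, blk v = Some k -> (0 < lv v)%N) ->
  (forall k, k != ord0 -> exists v, blk v = Some k) ->
  (forall i j, i != j -> a0 i * a1 j - a0 j * a1 i != 0) ->
  (forall (th : 'I_N -> F) u0 u1, (forall k,
     ('X_[ymon blk lv k] : {mpoly F[N]}).@[th] = a0 k * u0 + a1 k * u1) ->
     forall i, (g i).@[th] = 0) ->
  (forall k, qclass g 'X_[ymon blk lv k] =
     qcst g (a0 k) * z0 + qcst g (a1 k) * z1) ->
  (forall i, exists v, mhomog (block_lattice blk lv) v (g i)) ->
  (forall i v, Q i v =
     (ymon blk lv (lift ord0 i) v)%:Z - (ymon blk lv ord0 v)%:Z) ->
  admissible_matrix P ->
  factorially_graded comp (fun c : F => qclass g c%:MP) (vdeg P)
    (fun i => qclass g 'X_i).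
Proof.
move=> P comp lv_gt0 ne indep pts cy hom QE P_ok.
have pts' (th : 'I_N -> F) u0 u1 : (forall k,
    \prod_j th j ^+ ymon blk lv k j = a0 k * u0 + a1 k * u1) ->
    forall i, (g i).@[th] = 0.
  by move=> thE; apply: (pts th u0 u1) => k; rewrite mevalX.
have latE : row_lattice Q d 0 = block_lattice blk lv.
  by rewrite row_lattice_init (block_lattice_rows QE).
apply: quotient_graded_ring => //.
- by move=> u; have [_ _ /row_full_injective] := P_ok; apply.
- by rewrite latE.
- exact: (quot_neq0 r_gt0 lv_gt0 ne indep pts' cy).
- rewrite latE; exact: (block_const_factorial r_gt0 lv_gt0 ne indep pts' cy).
- rewrite latE; exact: (var_prime r_gt0 lv_gt0 ne indep pts' cy).
- exact: (var_nonassociated r_gt0 lv_gt0 ne indep pts' cy).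
Qed.

(** * The two types of rings R(A, P) *)

Section BlockPositions.
Variables (b : nat) (n_ : 'I_b -> nat) (m : nat).
Variable l : forall i, 'I_(n_ i) -> nat.

Definition vblock (v : 'I_(nvars n_ m)) : option 'I_b :=
  if split v is inl t then Some (tagnat.sig1 t) else None.

Definition vexp (v : 'I_(nvars n_ m)) : nat :=
  if split v is inl t then l (tagnat.sig2 t) else 0%N.

Lemma vblock_posT i (j : 'I_(n_ i)) : vblock (posT m j) = Some i.
Proof. by rewrite /vblock (unsplitK (inl _)) tagnat.Rank1K. Qed.

Lemma vexp_posT i (j : 'I_(n_ i)) : vexp (posT m j) = l j.
Proof.
rewrite /vexp (unsplitK (inl _)).
rewrite -[l (tagnat.sig2 _)]/((fun p => l (tagged p)) (tagnat.sig _)).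
by rewrite tagnat.rankK.
Qed.

Lemma posT_cases v : (exists i (j : 'I_(n_ i)), v = posT m j) \/ vblock v = None.
Proof.
rewrite /vblock; case: split_ordP => [t ->|k _]; last by right.
by left; exists (tagnat.sig1 t), (tagnat.sig2 t); rewrite /posT tagnat.sig2K.
Qed.

Lemma vexp_gt0 : (forall i (j : 'I_(n_ i)), (0 < l j)%N) ->
  forall v i, vblock v = Some i -> (0 < vexp v)%N.
Proof.
move=> l_gt0 v i; case: (posT_cases v) => [[i' [j ->]] _|->//].
by rewrite vexp_posT.
Qed.

Lemma block_exponent i v : (\sum_(j < n_ i) (posT m j == v) * l j)%N =
  if vblock v == Some i then vexp v else 0%N.
Proof.
have [[i' [j' ->]]|v0] := posT_cases v; last first.
  rewrite v0 big1 // => j _; case: eqP => // E.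
  by move: v0; rewrite -E vblock_posT.
rewrite vblock_posT vexp_posT (inj_eq Some_inj); case: eqP => [ii'|i'i].
  subst i'; rewrite (bigD1 j') //= eqxx mul1n big1 ?addn0 // => j jj'.
  case: eqP => // /lshift_inj/(congr1 (@nat_of_ord _))/eqP.
  by rewrite tagnat.eq_Rank eqxx /= val_eqE (negPf jj').
rewrite big1 // => j _; case: eqP => // /(congr1 vblock).
by rewrite !vblock_posT => -[/esym].
Qed.

Lemma block_monomialE (F : nzRingType) i : block_monomial m l F i =
  'X_[[multinom (if vblock v == Some i then vexp v else 0%N) | v < nvars n_ m]].
Proof.
rewrite /block_monomial mprodXnE; congr 'X_[_]; apply/mnmP => v.
rewrite mnm_sumE mnmE -block_exponent; apply: eq_bigr => j _.
by rewrite mulmnE mnm1E.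
Qed.

Lemma block_rowE i v :
  block_row m l i 0 v = (if vblock v == Some i then vexp v else 0%N)%:Z.
Proof.
rewrite -block_exponent /block_row summxE (big_morph _ PoszD (erefl 0%:Z)).
apply: eq_bigr => j _; rewrite !mxE /= eq_sym PoszM mulrC.
by case: (_ == _).
Qed.

End BlockPositions.

Lemma det_mx33 (R : comNzRingType) (M : 'M[R]_3) :
  let minor i j := M 1 i * M 2%:R j - M 1 j * M 2%:R i in
  \det M = M 0 0 * minor 1 2%:R - M 0 1 * minor 0 2%:R + M 0 2%:R * minor 0 1.
Proof.
have l1 : lift ord0 ord0 = 1 :> 'I_3 by apply: val_inj.
have l2 : lift ord0 (lift ord0 ord0) = 2%:R :> 'I_3 by apply: val_inj.
have l2' : lift ord0 (1 : 'I_2) = 2%:R :> 'I_3 by apply: val_inj.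
have l2'' : lift ord0 ord0 = 1 :> 'I_2 by apply: val_inj.
have l3 : lift (1 : 'I_3) ord0 = 0 by apply: val_inj.
have l4 : lift (1 : 'I_3) (1 : 'I_2) = 2%:R by apply: val_inj.
have l5 : lift (2%:R : 'I_3) ord0 = 0 by apply: val_inj.
have l6 : lift (2%:R : 'I_3) (1 : 'I_2) = 1 by apply: val_inj.
have l7 : lift (1 : 'I_2) ord0 = 0 by apply: val_inj.
have det2 (A : 'M[R]_2) : \det A = A 0 0 * A 1 1 - A 0 1 * A 1 0.
  rewrite (expand_det_row _ ord0) !big_ord_recl big_ord0 /cofactor !det_mx11 !mxE.
  rewrite !l2'' ?l7 /= ?expr0 ?expr1 mul1r addr0 mulN1r mulrN.
  by [].
rewrite (expand_det_row _ ord0) !big_ord_recl big_ord0 /cofactor !det2 !mxE.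
rewrite !l2'' !l1 ?l2 ?l2' ?l3 ?l4 ?l5 ?l6 /=.
rewrite -[(0 + 1 %% 3)%N]/1%N -[(0 + (1 %% 3 + 1 %% 3) %% 3)%N]/2%N.
by rewrite addn0 addr0 expr0 expr1 sqrrN expr1n mul1r mulN1r mul1r mulrN addrA.
Qed.

Lemma det_col_mx3 (R : comNzRingType) (Y : 'I_3 -> R) (B : 'I_2 -> 'I_3 -> R) :
  let minor i j := B 0 i * B 1 j - B 0 j * B 1 i in
  \det (col_mx (\row_v Y v) (\matrix_(u < 2, v < 3) B u v) : 'M_(1 + 2)) =
  Y 0 * minor 1 2%:R - Y 1 * minor 0 2%:R + Y 2%:R * minor 0 1.
Proof.
set M := col_mx _ _.
have M0 v : M 0 v = Y v.
  by rewrite (_ : 0 = lshift 2 (0 : 'I_1)) ?col_mxEu ?mxE //; apply: val_inj.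
have M1 v : M 1 v = B 0 v.
  by rewrite (_ : 1 = rshift 1 (0 : 'I_2)) ?col_mxEd ?mxE //; apply: val_inj.
have M2 v : M 2%:R v = B 1 v.
  by rewrite (_ : 2%:R = rshift 1 (1 : 'I_2)) ?col_mxEd ?mxE //; apply: val_inj.
by rewrite (det_mx33 (M : 'M_3)) /= !M0 !M1 !M2.
Qed.

Lemma free_pair_minor (F : fieldType) (n : nat) (a : 'M[F]_(2, n)) i j :
  free [:: col i a; col j a] -> a 0 i * a 1 j - a 0 j * a 1 i != 0.
Proof.
rewrite free_cons span_seq1 seq1_free => /andP[+ aj].
apply: contra; rewrite subr_eq0 => /eqP E.
have vec2 (x y : 'cV[F]_2) : x 0 0 = y 0 0 -> x 1 0 = y 1 0 -> x = y.
  move=> E0 E1; apply/matrixP => u v; rewrite (ord1 v).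
  by case: (unliftP ord0 u) => [w ->|->//]; rewrite (ord1 w) (_ : lift _ _ = 1) //;
    apply: val_inj.
apply/vlineP; have [a0|a0] := eqVneq (a 0 j) 0; last first.
  exists (a 0 i / a 0 j); apply: vec2; rewrite !mxE ?divfK //.
  by rewrite mulrAC E mulrAC mulfV ?mul1r.
have a1 : a 1 j != 0.
  by apply: contraNneq aj => a1; apply/eqP/vec2; rewrite !mxE.
exists (a 1 i / a 1 j); apply: vec2; rewrite !mxE ?divfK // a0 mulr0.
by apply: (mulIf a1); rewrite E a0 !mul0r.
Qed.

Lemma qclass_gen (F : fieldType) (N k : nat) (g : 'I_k -> {mpoly F[N]}) i :
  qclass g (g i) = 0.
Proof.
apply/qclass_eq0/asboolP; exists (fun j => (j == i)%:R).
by rewrite (bigD1 i) //= eqxx mul1r big1 ?addr0 // => j /negPf->; rewrite mul0r.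
Qed.

Lemma qcst_can (F : fieldType) (N k : nat) (g : 'I_k -> {mpoly F[N]}) c x y :
  c != 0 -> qcst g c * x = qcst g c * y -> x = y.
Proof.
move=> c0 E; rewrite -[x]mul1r -[y]mul1r -(rmorph1 (qcst g)) -(mulVf c0).
by rewrite rmorphM -!mulrA E.
Qed.

Lemma mhomog_mulC (F : fieldType) (N : nat) (L : 'cV[int]_N -> Prop) w c
    (p : {mpoly F[N]}) : mhomog L w p -> mhomog L w (p * c%:MP).
Proof. by move=> hp; rewrite mulrC mul_mpolyC; apply: mhomogZ. Qed.

Section TypeOne.
Variables (F : closedFieldType) (r m : nat) (r_gt0 : (0 < r)%N) (a : 'I_r -> F).
Variables (n_ : 'I_(nblocks (TypeOne a)) -> nat).
Variable l : forall i, 'I_(n_ i) -> nat.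

(* The missing block of index 0 is read as an empty one, with monomial 1 and
   a_0 = (0, 1): then T_i^l_i = z_0 - a_i z_1 with z_1 = 1. *)
Let blk (v : 'I_(nvars n_ m)) : option 'I_r.+1 := omap (lift ord0) (vblock v).
Let y k : {mpoly F[nvars n_ m]} := 'X_[ymon blk (vexp l) k].
Let c0 (k : 'I_r.+1) : F := if unlift ord0 k is Some _ then 1 else 0.
Let c1 (k : 'I_r.+1) : F := if unlift ord0 k is Some i then - a i else 1.
Let g := relations m l.

Lemma ymon_lift i : ymon blk (vexp l) (lift ord0 i) =
  [multinom (if vblock v == Some i then vexp l v else 0%N) | v < nvars n_ m].
Proof.
by apply/mnmP => v; rewrite !mnmE /blk; case: (vblock v).
Qed.

Lemma ymon_ord0 : ymon blk (vexp l) ord0 = 0%MM.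
Proof. by apply/mnmP => v; rewrite !mnmE /blk; case: (vblock v). Qed.

Lemma typeone_relE (i : 'I_r.-1) : exists j k : 'I_r,
  [/\ j = i :> nat, k = i.+1 :> nat & g i = y (lift ord0 j) - y (lift ord0 k) - (a k - a j)%:MP].
Proof.
exists (@consecutive 0 r i 0), (@consecutive 0 r i 1).
split=> //=; rewrite ?addn0 ?addn1 //.
by rewrite /y !ymon_lift /g /relations !block_monomialE.
Qed.

(** The relation between neighbouring blocks says that [T_i^l_i + a_i] is the same for both; the
    common value over all blocks serves as [z_0]. *)
Lemma typeone_class k : qclass g (y k) =
  qcst g (c0 k) *
    (qclass g (y (lift ord0 (Ordinal r_gt0))) + qcst g (a (Ordinal r_gt0)))
  + qcst g (c1 k) * 1.
Proof.
rewrite /c0 /c1; case: unliftP => [i|] ->; last first.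
  by rewrite /y ymon_ord0 mpolyX0 !rmorph1 rmorph0 mul0r add0r mulr1.
rewrite rmorph1 mul1r mulr1 rmorphN.
suff E : qclass g (y (lift ord0 i)) + qcst g (a i) =
    qclass g (y (lift ord0 (Ordinal r_gt0))) + qcst g (a (Ordinal r_gt0)).
  by rewrite -E addrK.
case: i; elim=> [|i IHi] ir; first by rewrite (bool_irrelevance ir r_gt0).
have i'r : (i < r.-1)%N by rewrite -ltnS prednK.
have [j [j' [ji ki Eg]]] := typeone_relE (Ordinal i'r).
have Ej : j = Ordinal (ltnW ir) by apply: val_inj.
have Ek : j' = Ordinal ir by apply: val_inj.
rewrite -(IHi (ltnW ir)) -Ej -Ek; apply/eqP; rewrite eq_sym -subr_eq0.
have := qclass_gen g (Ordinal i'r); rewrite Eg !rmorphB /= => <-.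
by rewrite -/(qcst g (a j)) -/(qcst g (a j')); apply/eqP; ring.
Qed.

Lemma typeone_graded s (d : 'M[int]_(s, nvars n_ m)) : injective a ->
  (forall i, (0 < n_ i)%N) -> (forall i j, (0 < l (i := i) j)%N) ->
  admissible_matrix (Pmx l d) ->
  factorially_graded (RAP_component l d) (RAP_const m l) (vdeg (Pmx l d))
    (RAP_var m l).
Proof.
move=> a_inj n_gt0 l_gt0 P_ok.
apply: (@pencil_quotient_graded F _ r s r_gt0 blk (vexp l) c0 c1 _ g _ _ _ d)
  => //.
- move=> v k; rewrite /blk; case E: (vblock v) => [i|//] _.
  exact: (vexp_gt0 l_gt0 E).
- move=> k k0; case: (unliftP ord0 k) => [i ->|E]; last by rewrite E eqxx in k0.
  by exists (posT m (Ordinal (n_gt0 i))); rewrite /blk vblock_posT.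
- move=> i j; rewrite /c0 /c1.
  case: unliftP => [i' ->|->]; case: unliftP => [j' ->|->]; rewrite ?eqxx //.
  + rewrite (inj_eq lift_inj) !mul1r opprK addrC subr_eq0 => ij.
    by apply: contraNneq ij => /a_inj->.
  + by rewrite mul0r subr0 mulr1 oner_eq0.
  + by rewrite mul0r mulr1 sub0r oppr_eq0 oner_eq0.
- move=> th u0 u1 thE i; have [j [k [_ _ ->]]] := typeone_relE i.
  rewrite !mevalB mevalC /y !thE /c0 /c1 !liftK.
  (* The empty block has monomial 1, which fixes [u1 = 1] and makes the constant term of the
     relation match. *)
  have := thE ord0.
  rewrite ymon_ord0 mpolyX0 meval1 /c0 /c1 unlift_none mul0r add0r mul1r.
  by move=> <-; ring.
- exact: typeone_class.
- move=> i; have [j [k [_ _ ->]]] := typeone_relE i.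
  exists (mdegree (ymon blk (vexp l) ord0)); apply: mhomogB; first apply: mhomogB.
  + exact: ymon_homog.
  + exact: ymon_homog.
  + by rewrite ymon_ord0 mdegree0; apply: mhomogC; apply: block_lattice0.
- by move=> i v; rewrite /P0 mxE block_rowE ymon_ord0 ymon_lift !mnmE subr0.
Qed.

End TypeOne.

Section TypeTwo.
Variables (F : closedFieldType) (r m : nat) (r_gt0 : (0 < r)%N).
Variables (a : 'M[F]_(2, r.+1)).
Variables (n_ : 'I_(nblocks (TypeTwo a)) -> nat).
Variable l : forall i, 'I_(n_ i) -> nat.

Let y k : {mpoly F[nvars n_ m]} := 'X_[ymon (@vblock _ n_ m) (vexp l) k].
Let g := relations m l.
Let minor i j := a 0 i * a 1 j - a 0 j * a 1 i.

Lemma typetwo_relE (i : 'I_r.-1) : exists j0 j1 j2 : 'I_r.+1,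
  [/\ j0 = i :> nat, j1 = i.+1 :> nat, j2 = i.+2 :> nat &
      g i = y j0 * (minor j1 j2)%:MP - y j1 * (minor j0 j2)%:MP
            + y j2 * (minor j0 j1)%:MP].
Proof.
exists (@consecutive 1 r i 0), (@consecutive 1 r i 1), (@consecutive 1 r i 2%:R).
split=> //=; rewrite ?addn0 ?addn1 ?addn2 //.
rewrite /g /relations det_col_mx3 /= !block_monomialE /minor.
by rewrite !rmorphB !rmorphM.
Qed.

Hypothesis a_ok : forall i j, i != j -> minor i j != 0.

(** Cramer's rule for the first two blocks defines [z0] and [z1]. Each relation then determines the
    last of three consecutive block monomials from the other two, because the minor in front of it
    is non-zero. *)
Lemma typetwo_class : exists z0 z1 : quot_ring g, forall k,
  qclass g (y k) = qcst g (a 0 k) * z0 + qcst g (a 1 k) * z1.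
Proof.
pose k1 : 'I_r.+1 := Ordinal (r_gt0 : (1 < r.+1)%N).
have D0 : minor ord0 k1 != 0 by apply: a_ok.
pose D := minor ord0 k1; rewrite -/D in D0.
pose Y k := qclass g (y k).
exists (qcst g D^-1 * (qcst g (a 1 k1) * Y ord0 - qcst g (a 1 ord0) * Y k1)).
exists (qcst g D^-1 * (qcst g (a 0 ord0) * Y k1 - qcst g (a 0 k1) * Y ord0)).
set z0 := qcst g _ * _; set z1 := qcst g _ * (qcst g (a 0 _) * _ - _).
have DV : qcst g D * qcst g D^-1 = 1 by rewrite -rmorphM mulfV // rmorph1.
have DE : qcst g D = qcst g (a 0 ord0) * qcst g (a 1 k1) -
    qcst g (a 0 k1) * qcst g (a 1 ord0) by rewrite rmorphB !rmorphM.
have unscale k : Y k = qcst g D^-1 * (qcst g D * Y k).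
  by rewrite mulrA [_ * qcst g D]mulrC DV mul1r.
case=> k; elim/ltn_ind: k => -[|[|k]] IHk kr.
- have -> : Ordinal kr = ord0 by apply: val_inj.
  rewrite -/(Y _) (unscale ord0) DE /z0 /z1; ring.
- have -> : Ordinal kr = k1 by apply: val_inj.
  rewrite -/(Y _) (unscale k1) DE /z0 /z1; ring.
have kr' : (k < r.-1)%N by rewrite -ltnS prednK.
have [j0 [j1 [j2 [E0 E1 E2 Eg]]]] := typetwo_relE (Ordinal kr').
have kr0 : (k < r.+1)%N by apply: leq_trans kr; rewrite ltnW.
have kr1 : (k.+1 < r.+1)%N by apply: leq_trans kr.
have Ej0 : j0 = Ordinal kr0 by apply: val_inj.
have Ej1 : j1 = Ordinal kr1 by apply: val_inj.
have Ej2 : j2 = Ordinal kr by apply: val_inj.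
have := IHk k (leqnSn _) kr0; have := IHk k.+1 (leqnn _) kr1.
rewrite -Ej0 -Ej1 -Ej2 => Y1 Y0.
have j01 : minor j0 j1 != 0 by apply: a_ok; rewrite -val_eqE /= E0 E1 ltn_eqF.
apply: (qcst_can j01).
have := qclass_gen g (Ordinal kr'); rewrite Eg rmorphD rmorphB !rmorphM /=.
rewrite -!/(qcst g _) Y0 Y1 /minor !rmorphB !rmorphM => H.
apply/eqP; rewrite -subr_eq0; apply/eqP; rewrite -[RHS]H; ring.
Qed.

Lemma typetwo_graded s (d : 'M[int]_(s, nvars n_ m)) :
  (forall i, (0 < n_ i)%N) -> (forall i j, (0 < l (i := i) j)%N) ->
  admissible_matrix (Pmx l d) ->
  factorially_graded (RAP_component l d) (RAP_const m l) (vdeg (Pmx l d))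
    (RAP_var m l).
Proof.
move=> n_gt0 l_gt0 P_ok; have [z0 [z1 zE]] := typetwo_class.
apply: (@pencil_quotient_graded F _ r s r_gt0 (@vblock _ n_ m) (vexp l)
  (a 0) (a 1) _ g z0 z1 _ d) => //.
- by move=> v k; apply: vexp_gt0.
- move=> k _; exists (posT m (Ordinal (n_gt0 k))); exact: vblock_posT.
- move=> th u0 u1 thE i; have [j0 [j1 [j2 [_ _ _ ->]]]] := typetwo_relE i.
  (* At such a point the first row of the determinant is a linear combination of the other two. *)
  rewrite mevalD mevalB !mevalM !mevalC /y !thE /minor; ring.
- move=> i; have [j0 [j1 [j2 [_ _ _ ->]]]] := typetwo_relE i.
  exists (mdegree (ymon (@vblock _ n_ m) (vexp l) ord0)).
  by apply: mhomogD; first apply: mhomogB; apply: mhomog_mulC; apply: ymon_homog.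
- by move=> i v; rewrite /P0 !mxE !block_rowE !mnmE.
Qed.

End TypeTwo.

Theorem theorem1p5 (F : closedFieldType) (F_char0 : [pchar F] =i pred0)
    (r m s : nat) (r_gt0 : (0 < r)%N)
    (A : block_data F r) (A_ok : block_data_ok A)
    (n_ : 'I_(nblocks A) -> nat) (n_gt0 : forall i, (0 < n_ i)%N)
    (l : forall i, 'I_(n_ i) -> nat) (l_gt0 : forall i j, (0 < l i j)%N)
    (s_bounds : (1 <= s <= nvars n_ m - r)%N)
    (d : 'M[int]_(s, nvars n_ m)) (P_ok : admissible_matrix (Pmx l d)) :
  [/\ almost_free (vdeg (Pmx l d)),
      factorial_grading (RAP_component l d) &
      forall x : RAP m l, homogeneous (RAP_component l d) x ->
        is_unit x -> exists2 c : F, c != 0 & x = RAP_const m l c] /\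
  [/\ forall i, graded_prime (RAP_component l d) (RAP_var m l i),
      forall i j, i != j -> RAP_var m l i <> RAP_var m l j,
      forall i j, i != j -> ~ associated (RAP_var m l i) (RAP_var m l j) &
      algebra_generators (RAP_const m l) (RAP_var m l)].
Proof.
case: A A_ok n_ n_gt0 l l_gt0 s_bounds d P_ok
  => a /= a_ok n_ n_gt0 l l_gt0 _ d P_ok.
  exact: typeone_graded.
by apply: typetwo_graded => // i j ij; apply: free_pair_minor; apply: a_ok.
Qed.
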